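(* Let $k$ be any field and let $G$ be a connected circulant cubic graph. Then $G$ is Cohen-Macaulay (over $k$) if and only if $G$ is isomorphic to $C_4(1,2)$ or $C_6(2,3)$.
   Context: Circulant graphs: given an integer $n \geq 1$ and $S \subseteq \{1,2,\ldots,\lfloor n/2 \rfloor\}$, the circulant graph $C_n(S)$ is the finite simple graph on vertices $\{x_1,\ldots,x_n\}$ such that $\{x_i,x_j\}$ (with $i \ne j$) is an edge if and only if $\min\{|i-j|,\, n-|i-j|\} \in S$. Set brackets are suppressed, e.g. $C_4(1,2) = C_4(\{1,2\})$. A cubic graph is a graph in which every vertex has degree $3$. (A circulant cubic graph is thus of the form $C_{2n}(a,n)$ for some $1 \leq a < n$.) Cohen-Macaulay graphs: for a finite simple graph $G$ on $\{x_1,\ldots,x_m\}$, let $R = k[x_1,\ldots,x_m]$ and let $I(G) = \langle x_ix_j : \{x_i,x_j\} \text{ is an edge of } G\rangle$ be the edge ideal. $G$ is Cohen-Macaulay if $R/I(G)$ is a Cohen-Macaulay ring, i.e. its Krull dimension equals its depth, where depth is the length of the longest regular sequence on $R/I(G)$ in $\langle x_1,\ldots,x_m\rangle$. *)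

(* Defs.v *)
From HB Require Import structures.
From mathcomp Require Import all_boot all_order all_algebra.
From mathcomp Require Import boolp.
From mathcomp Require Import mpoly.

Set Implicit Arguments.
Unset Strict Implicit.
Unset Printing Implicit Defensive.

Import GRing.Theory IntDist.
Local Open Scope ring_scope.

(* Finite simple graphs on m labelled vertices, indexed by 0, ..., m-1. *)
Record sgraph (m : nat) := SGraph {
  adj : rel 'I_m;
  adj_sym : ssrbool.symmetric adj;
  adj_irrefl : irreflexive adj
}.

Definition sg_iso m n (G : sgraph m) (H : sgraph n) : Prop :=
  exists2 f : 'I_m -> 'I_n,
    bijective f & forall x y, adj H (f x) (f y) = adj G x y.

Definition sg_connected m (G : sgraph m) : Prop :=
  (0 < m)%N /\ forall x y, connect (adj G) x y.

Definition cubic m (G : sgraph m) : Prop :=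
  forall x, #|[set y | adj G x y]| = 3%N.

Section Circulant.
Variables (n : nat) (S : seq nat).

Definition circulant_rel : rel 'I_n :=
  fun i j => let d := `|(i : nat) - (j : nat)|%N in
    (i != j) && (minn d (n - d) \in S).

Lemma circulant_rel_sym : ssrbool.symmetric circulant_rel.
Proof. by move=> i j; rewrite /circulant_rel eq_sym distnC. Qed.

Lemma circulant_rel_irrefl : irreflexive circulant_rel.
Proof. by move=> i; rewrite /circulant_rel eqxx. Qed.

(* The graph C_n(S); the condition that S is contained in {1, ..., n./2} is
   imposed in is_circulant. *)
Definition circulant : sgraph n :=
  SGraph circulant_rel_sym circulant_rel_irrefl.

End Circulant.

Definition is_circulant m (G : sgraph m) : Prop :=
  exists n (S : seq nat),
    [/\ (0 < n)%N, {in S, forall s, (1 <= s <= n./2)%N}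
      & sg_iso G (circulant n S)].

Definition ideal_gen (R : comNzRingType) (gs : seq R) (x : R) : Prop :=
  exists c : nat -> R, x = \sum_(i < size gs) c i * gs`_i.

Definition is_max (P : nat -> Prop) (d : nat) : Prop :=
  P d /\ forall e, P e -> (e <= d)%N.

(* A strict chain P 0 < P 1 < ... < P d of prime ideals; idealr_closed already
   includes properness.  As subsets are classically boolean predicates
   (boolp), ranging over {pred A} loses no ideal. *)
Definition prime_chain (A : comNzRingType) (d : nat) : Prop :=
  exists P : nat -> {pred A},
    (forall i, (i <= d)%N -> idealr_closed (P i) /\ prime_idealr_closed (P i)) /\
    (forall i, (i < d)%N ->
       {subset P i <= P i.+1} /\ exists2 x, x \in P i.+1 & x \notin P i).

Definition is_krull_dim (A : comNzRingType) : nat -> Prop :=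
  is_max (prime_chain A).

(* The submodule (f_0, ..., f_(i-1)) M of M, where f = s. *)
Definition seq_submod (R : comNzRingType) (M : lmodType R) (s : seq R) (i : nat)
    (x : M) : Prop :=
  exists y : nat -> M, x = \sum_(j < i) s`_j *: y j.

(* Each s`_i is a nonzerodivisor on M / (s`_0, ..., s`_(i-1)) M, and the
   quotient of M by the whole sequence is nonzero. *)
Definition regular_sequence (R : comNzRingType) (M : lmodType R) (s : seq R)
    : Prop :=
  (forall i, (i < size s)%N ->
     forall x : M, seq_submod s i (s`_i *: x) -> seq_submod s i x) /\
  exists x : M, ~ seq_submod s (size s) x.

Definition is_depth (R : comNzRingType) (J : R -> Prop) (M : lmodType R)
    : nat -> Prop :=
  is_max (fun r => exists s : seq R,
    [/\ size s = r, forall f, f \in s -> J f & regular_sequence M s]).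

(* R / I as an R-module. *)
Section QuotientModule.
Variables (R : comNzRingType) (I : idealr R).
Local Open Scope quotient_scope.

Definition quot_scale (a : R) (x : {ideal_quot I}) : {ideal_quot I} :=
  \pi_{ideal_quot I} a * x.

Lemma quot_scaleA a b x :
  quot_scale a (quot_scale b x) = quot_scale (a * b) x.
Proof. by rewrite /quot_scale mulrA -rmorphM. Qed.

Lemma quot_scale1 : left_id 1 quot_scale.
Proof. by move=> x; rewrite /quot_scale rmorph1 mul1r. Qed.

Lemma quot_scaleDr : right_distributive quot_scale +%R.
Proof. by move=> a x y; rewrite /quot_scale mulrDr. Qed.

Lemma quot_scaleDl x : {morph quot_scale^~ x : a b / a + b}.
Proof. by move=> a b; rewrite /quot_scale rmorphD mulrDl. Qed.

HB.instance Definition _ := GRing.Zmodule_isLmodule.Build R {ideal_quot I}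
  quot_scaleA quot_scale1 quot_scaleDr quot_scaleDl.

End QuotientModule.

Section EdgeIdeal.
Variables (k : fieldType) (m : nat) (G : sgraph m).

Definition edge_gens : seq {mpoly k[m]} :=
  [seq 'X_e.1 * 'X_e.2 | e <- enum [pred e : 'I_m * 'I_m | adj G e.1 e.2]].

Definition edge_ideal : {pred {mpoly k[m]}} :=
  [pred p | `[< ideal_gen edge_gens p >]].

Lemma edge_ideal_closed : idealr_closed edge_ideal.
Proof.
split=> [||a p q].
- apply/asboolP; exists (fun=> 0).
  by rewrite big1 // => i _; rewrite mul0r.
- apply/asboolP=> -[c] /(congr1 (meval (fun=> 0))).
  rewrite meval1 raddf_sum /= big1 => [/eqP|i _]; first by rewrite oner_eq0.
  rewrite mevalM; have /mapP[e _ ->] := mem_nth 0 (ltn_ord i).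
  by rewrite mevalM mevalXU mul0r mulr0.
- move=> /asboolP[c ->] /asboolP[d ->]; apply/asboolP.
  exists (fun i => a * c i + d i).
  rewrite mulr_sumr -big_split /=; apply: eq_bigr => i _.
  by rewrite mulrDl mulrA.
Qed.

HB.instance Definition _ :=
  isIdealr.Build {mpoly k[m]} edge_ideal edge_ideal_closed.

Definition edge_ring : comNzRingType := {ideal_quot edge_ideal}.

Definition edge_module : lmodType {mpoly k[m]} := {ideal_quot edge_ideal}.

Definition max_ideal : {mpoly k[m]} -> Prop :=
  ideal_gen [seq 'X_i | i <- enum 'I_m].

Definition cohen_macaulay : Prop :=
  exists d, is_krull_dim edge_ring d /\ is_depth max_ideal edge_module d.

End EdgeIdeal.

(* Main.v *)
(* The ring k[V]/I(G) has dimension at least the size of any independent set of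
   G.  Upper bounds for its depth come from Koszul cohomology: a regular sequence
   of length r in the maximal ideal kills it in degrees below r, and a multigraded
   component of the Koszul complex of suitable powers of the variables is the
   cochain complex of the link of an independent set F in the independence complex.
   So a facet F bounds the depth by |F|, a disconnected independence complex by 1
   and a nonzero first cohomology class by 2.

   Write G as C_2h(a,h).  Let v = 0 and F1 = {h + 2a, h - 2a}.  Unless 2a, 3a or 4a
   equals h, or 3a or 5a vanishes, modulo 2h, the set F1 is independent, stays away
   from v and its neighbours, and dominates all vertices at distance two from v.
   Hence G has maximal independent sets of different sizes and is not
   Cohen-Macaulay.  As a and h are coprime by connectedness, this leaves (a,h) =
   (1,2), (1,3), (1,4), (3,4), (2,3), (2,5), (4,5).  For (1,3) the independence
   complex is disconnected, and for h = 4, 5 it has a first cohomology class while G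
   has independent sets of size 3.  The cases (1,2) and (2,3) are Cohen-Macaulay:
   the sums of the variables over the parts of a partition into one or two cliques
   form a regular sequence, and a chain of primes is no longer than an independent
   set, since algebraically independent sets of variables grow strictly when passing
   to a smaller prime. *)

Require Import Defs.
From HB Require Import structures.
From mathcomp Require Import all_boot all_order all_algebra.
From mathcomp Require Import boolp mpoly zify ring.

Set Implicit Arguments.
Unset Strict Implicit.
Unset Printing Implicit Defensive.

Import GRing.Theory IntDist.
Local Open Scope ring_scope.

(** * Koszul cohomology and regular sequences *)

Section Koszul.
Variables (T : finType) (r : T -> nat) (r_inj : injective r).
Variables (R : comNzRingType) (M : lmodType R) (y : T -> R).
Implicit Types (A B : {set T}) (c b : {set T} -> M).

(** The injection [r] orders the indices; for [i] in [A] this is the sign of moving [e_i] from the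
    front to its place in the wedge product [e_A]. *)
Definition ksign (i : T) A : R := (-1) ^+ #|[set j in A | (r j < r i)%N]|.

(** Left multiplication by the sum of the [y i e_i] on the exterior algebra over [M], with [c A] the
    coefficient of [e_A]; one function holds all degrees. *)
Definition kdiff c A : M := \sum_(i in A) (ksign i A * y i) *: c (A :\ i).

(** Contraction with the dual vector of [e_i]. *)
Definition khomotopy (i : T) c A : M :=
  if i \in A then 0 else ksign i A *: c (i |: A).

Lemma ksign_sqr i A : ksign i A * ksign i A = 1.
Proof. by rewrite /ksign -expr2 sqrr_sign. Qed.

Lemma ksignU1 i j A : j \notin A ->
  ksign i (j |: A) = (-1) ^+ (r j < r i)%N * ksign i A.
Proof.
move=> jA; rewrite /ksign -exprD; congr (_ ^+ _).
rewrite (cardsD1 j) !inE eqxx /=; congr (_ + _)%N; apply: eq_card => x.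
by rewrite !inE; case: eqP => [->|] //=; rewrite (negPf jA).
Qed.

Lemma ksignD1 i j A : j \in A ->
  ksign i A = (-1) ^+ (r j < r i)%N * ksign i (A :\ j).
Proof. by move=> jA; rewrite -{1}(setD1K jA) ksignU1 // !inE eqxx. Qed.

Lemma ksignU1_id i A : i \notin A -> ksign i (i |: A) = ksign i A.
Proof. by move=> iA; rewrite ksignU1 // ltnn mul1r. Qed.

Lemma sign_ltn_anti i j : i != j ->
  (-1) ^+ (r i < r j)%N = - (-1) ^+ (r j < r i)%N :> R.
Proof.
move=> ij; case: (ltngtP (r i) (r j)) => [||/r_inj/eqP]; last by rewrite (negPf ij).
  by rewrite expr1 expr0.
by rewrite expr1 expr0 opprK.
Qed.

(** Contraction by [i] anticommutes with wedging by [e_j] for [j != i], so only the term [j = i]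
    survives, with its sign squared. *)
Lemma kdiff_homotopy i c A :
  kdiff (khomotopy i c) A + khomotopy i (kdiff c) A = y i *: c A.
Proof.
rewrite /kdiff /khomotopy; case: ifPn => iA.
  rewrite addr0 (bigD1 i) //= !inE eqxx big1 => [|j /andP[jA ji]]; last first.
    by rewrite !inE eq_sym ji iA /= scaler0.
  rewrite addr0 setD1K // scalerA (ksignD1 i iA) ltnn mul1r mulrAC.
  by rewrite ksign_sqr mul1r.
rewrite scaler_sumr big_setU1 //= ksignU1_id // setU1K //.
rewrite addrCA -[RHS]addr0; congr (_ + _).
  by rewrite scalerA mulrA ksign_sqr mul1r.
rewrite -big_split big1 //= => j jA.
have ij : i != j by apply: contraNneq iA => ->.
rewrite !inE ij (negPf iA) /= !scalerA.
have -> : i |: A :\ j = (i |: A) :\ j.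
  by apply/setP=> x; rewrite !inE; case: (x =P i) => [->|]; rewrite ?ij.
rewrite -scalerDl ksignU1 // (ksignD1 i jA) (sign_ltn_anti ij).
rewrite [X in X *: _](_ : _ = 0) ?scale0r //.
set w := (-1) ^+ _; set u := ksign j A; set v := ksign i _.
transitivity (u * y j * v * (1 - w * w)); first by ring.
by rewrite -expr2 sqrr_sign subrr mulr0.
Qed.

Lemma kdiff_kdiff c A : kdiff (kdiff c) A = 0.
Proof.
rewrite /kdiff; under eq_bigr do rewrite scaler_sumr.
pose G i j := (ksign i A * y i) *: ((ksign j (A :\ i) * y j) *: c (A :\ i :\ j)).
have GE i j : i \in A -> j \in A -> i != j -> G i j = - G j i.
  move=> iA jA ij; rewrite /G !scalerA setDDl setUC -setDDl -scaleNr.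
  rewrite (ksignD1 i jA) (ksignD1 j iA) (sign_ltn_anti ij).
  by congr (_ *: _); ring.
(* Every pair is removed in both orders; the double sum is split by rank so that one half, after
   exchange, cancels the other. *)
rewrite (eq_bigr (fun i => \sum_(j in A | (r j < r i)%N) G i j +
                           \sum_(j in A | (r i < r j)%N) G i j)); last first.
  move=> i iA; rewrite (bigID (fun j => (r j < r i)%N)) /=.
  congr (_ + _); apply: eq_bigl => j; rewrite !inE.
    by case: eqP => [->|]; rewrite ?ltnn ?andbF.
  case: eqP => [->|/eqP ji]; rewrite ?ltnn ?andbF //= -leqNgt leq_eqVlt.
  by rewrite (inj_eq r_inj) eq_sym (negPf ji).
rewrite big_split /= [X in _ + X](exchange_big_dep (mem A)) /=; last first.
  by move=> i j _ /andP[].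
rewrite -[X in _ + X]opprK -sumrN; apply/eqP; rewrite subr_eq0; apply/eqP.
apply: eq_bigr => i iA; rewrite -sumrN; apply: eq_big => [j|j /andP[jA ji]].
  by rewrite iA.
by rewrite GE //; apply: contraTneq ji => ->; rewrite ltnn.
Qed.

Lemma kdiffD c b A : kdiff (fun B => c B + b B) A = kdiff c A + kdiff b A.
Proof. by rewrite -big_split /=; apply: eq_bigr => i _; rewrite scalerDr. Qed.

Lemma kdiffZ (a : R) c A : kdiff (fun B => a *: c B) A = a *: kdiff c A.
Proof.
by rewrite scaler_sumr; apply: eq_bigr => i _; rewrite !scalerA mulrC.
Qed.

Lemma kdiff_sum (I : finType) (F : I -> {set T} -> M) A :
  kdiff (fun B => \sum_i F i B) A = \sum_i kdiff (F i) A.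
Proof.
by rewrite exchange_big; apply: eq_bigr => i _; rewrite scaler_sumr.
Qed.

Lemma kdiff_homotopy_sum (a : T -> R) c A :
  kdiff (fun B => \sum_i a i *: khomotopy i c B) A
  + \sum_i a i *: khomotopy i (kdiff c) A = (\sum_i a i * y i) *: c A.
Proof.
rewrite kdiff_sum -big_split scaler_suml /=; apply: eq_bigr => i _.
by rewrite kdiffZ -scalerDr kdiff_homotopy scalerA.
Qed.

Definition homogeneous_cochain i c := forall A, #|A| != i -> c A = 0.

Section RegularSequence.
Variable s : seq R.
Hypothesis s_reg : forall j, (j < size s)%N ->
  forall x : M, seq_submod s j (s`_j *: x) -> seq_submod s j x.
Hypothesis s_nilp : forall f, f \in s ->
  exists N (a : T -> R), f ^+ N = \sum_i a i * y i.

Lemma seq_submod0 j : seq_submod s j (0 : M).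
Proof. by exists (fun=> 0); rewrite big1 // => i _; rewrite scaler0. Qed.

Lemma seq_submodD j (u v : M) :
  seq_submod s j u -> seq_submod s j v -> seq_submod s j (u + v).
Proof.
move=> [f ->] [g ->]; exists (fun i => f i + g i).
by rewrite -big_split /=; apply: eq_bigr => i _; rewrite scalerDr.
Qed.

Lemma seq_submodZ j a (u : M) : seq_submod s j u -> seq_submod s j (a *: u).
Proof.
move=> [f ->]; exists (fun i => a *: f i).
by rewrite scaler_sumr; apply: eq_bigr => i _; rewrite !scalerA mulrC.
Qed.

Lemma seq_submod_sum j I (q : seq I) (P : pred I) (F : I -> M) :
  (forall i, P i -> seq_submod s j (F i)) -> seq_submod s j (\sum_(i <- q | P i) F i).
Proof.
move=> sF; elim/big_rec: _ => [|i x Pi sx]; first exact: seq_submod0.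
by apply: seq_submodD => //; apply: sF.
Qed.

Lemma seq_submodS j (u : M) :
  seq_submod s j.+1 u <-> exists v, seq_submod s j (u - s`_j *: v).
Proof.
split=> [[f ->]|[v [f fE]]].
  by exists (f j); exists f; rewrite big_ord_recr /= addrK.
exists (fun i => if (i < j)%N then f i else v).
rewrite big_ord_recr /= ltnn -[u](subrK (s`_j *: v)) fE; congr (_ + _).
by apply: eq_bigr => i _; rewrite ltn_ord.
Qed.

Lemma kdiff_submod j c : (forall A, seq_submod s j (c A)) ->
  forall A, seq_submod s j (kdiff c A).
Proof. by move=> sc A; apply: seq_submod_sum => i _; apply: seq_submodZ. Qed.

(* Koszul cohomology of M / (s_0, ..., s_(j-1)) M vanishes in degree i as long
   as i more elements of the sequence are left: s_j is injective on it by the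
   vanishing in degree i - 1 modulo s_j, and it acts nilpotently. *)
Lemma kcocycle_coboundary_mod i j c : (i + j < size s)%N ->
  homogeneous_cochain i c -> (forall A, seq_submod s j (kdiff c A)) ->
  exists2 g, (if i is i'.+1 then homogeneous_cochain i' g else forall A, g A = 0)
    & forall A, seq_submod s j (c A - kdiff g A).
Proof.
elim: i j c => [|i IHi] j c.
  rewrite add0n => ltjs c0 dc; exists (fun=> 0) => // A.
  have [//|nz] := EM (seq_submod s j (c A - kdiff (fun=> 0) A)).
  have kd0 B : kdiff (fun=> 0) B = 0 by apply: big1 => x _; rewrite scaler0.
  rewrite kd0 subr0; have [N [a fE]] := s_nilp (mem_nth 0 ltjs).
  (* In degree 0 all contractions of [c] vanish, so the homotopy formula leaves only multiples of
     [kdiff c]; regularity then strips the [N] factors. *)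
  have: seq_submod s j (s`_j ^+ N *: c A).
    rewrite fE -kdiff_homotopy_sum; apply: seq_submodD; last first.
      apply: seq_submod_sum => x _; apply: seq_submodZ.
      by rewrite /khomotopy; case: ifP => _; [exact: seq_submod0|exact: seq_submodZ].
    rewrite /kdiff; apply: seq_submod_sum => x _; rewrite big1 ?scaler0; last first.
      move=> z _; rewrite /khomotopy; case: ifPn => zA; rewrite ?scaler0 //.
      by rewrite c0 ?scaler0 // cardsU1 zA.
    exact: seq_submod0.
  elim: N {fE} => [|N IHN]; first by rewrite expr0 scale1r.
  by rewrite exprS -scalerA => /(s_reg ltjs).
move=> ltijs c0 dc.
have ltjs : (j < size s)%N by apply: leq_ltn_trans ltijs; rewrite leq_addl.
have [N [a fE]] := s_nilp (mem_nth 0 ltjs).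
(* One factor [s_j] is cancelled: if [s_j c'] is the coboundary of [b], then [b] is a cocycle modulo
   [s_j] as well, hence [b = kdiff e + s_j g] by induction, and [c' - kdiff g] is killed by
   [s_j]. *)
have step c' b : homogeneous_cochain i b ->
  (forall A, seq_submod s j (s`_j *: c' A - kdiff b A)) ->
  exists2 g, homogeneous_cochain i g & forall A, seq_submod s j (c' A - kdiff g A).
  move=> b0 cb.
  have [||e e0 be] := IHi j.+1 b _ b0; first by rewrite addnS.
    move=> A; apply/seq_submodS; exists (c' A).
    by rewrite -opprB -scaleN1r; apply: seq_submodZ.
  have /choice[g gE] : forall A, exists v,
    seq_submod s j ((b A - kdiff e A) - s`_j *: v).
    by move=> A; apply/seq_submodS.
  (* The chosen [g] is arbitrary outside degree [i], so it is truncated. *)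
  pose g' A := if #|A| == i then g A else 0.
  have g'0 : homogeneous_cochain i g' by move=> A /negPf nA; rewrite /g' nA.
  have eh A : #|A| != i -> kdiff e A = 0.
    move=> nA; apply: big1 => x xA; move: e0; case: (i) nA => [|i'] nA e0.
      by rewrite e0 scaler0.
    rewrite e0 ?scaler0 //; apply: contraNneq nA => <-.
    by rewrite (cardsD1 x A) xA.
  have g'E A : seq_submod s j ((b A - kdiff e A) - s`_j *: g' A).
    rewrite /g'; case: ifPn => [_|nA]; first exact: gE.
    by rewrite b0 // eh // scaler0 !subr0; apply: seq_submod0.
  exists g' => // A; apply: (s_reg ltjs); rewrite scalerBr -kdiffZ.
  rewrite -[X in X - _](subrK (kdiff b A)) -addrA; apply: seq_submodD => //.
  have -> : kdiff b A - kdiff (fun B => s`_j *: g' B) A =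
    kdiff (fun B => (b B - kdiff e B) - s`_j *: g' B) A + kdiff (kdiff e) A.
    rewrite -kdiffD -[RHS]addr0; apply/eqP; rewrite subr_eq; apply/eqP.
    rewrite addr0 -kdiffD; apply: eq_bigr => x _; congr (_ *: _).
    by rewrite addrAC !subrK.
  by rewrite kdiff_kdiff addr0; apply: kdiff_submod.
(* By the homotopy formula [s_j ^+ N] times [c] is a coboundary; [step] then lowers [N] to 0. *)
have: exists2 b, homogeneous_cochain i b
  & forall A, seq_submod s j (s`_j ^+ N *: c A - kdiff b A).
  exists (fun A => \sum_x a x *: khomotopy x c A).
    move=> A nA; apply: big1 => x _; rewrite /khomotopy.
    case: ifPn => xA; rewrite ?scaler0 // c0 ?scaler0 //.
    by rewrite cardsU1 xA.
  move=> A; rewrite fE -kdiff_homotopy_sum addrAC subrr add0r.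
  apply: seq_submod_sum => x _; apply: seq_submodZ.
  by rewrite /khomotopy; case: ifP => _; [exact: seq_submod0|exact: seq_submodZ].
elim: N {fE} => [|N IHN] [b b0 bE].
  by exists b => // A; have := bE A; rewrite expr0 scale1r.
apply: IHN; apply: step b0 _ => A; rewrite scalerA -exprS; exact: bE.
Qed.

Lemma kcocycle_coboundary i c : (i < size s)%N ->
  homogeneous_cochain i c -> (forall A, kdiff c A = 0) ->
  exists g, forall A, c A = kdiff g A.
Proof.
move=> lt_is c0 dc; have [||g _ gE] := @kcocycle_coboundary_mod i 0 c _ c0.
- by rewrite addn0.
- by move=> A; rewrite dc; apply: seq_submod0.
exists g => A; have [f] := gE A; rewrite big_ord0 => /eqP.
by rewrite subr_eq0 => /eqP.
Qed.

End RegularSequence.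
End Koszul.

(** * Independent sets, the faces of the independence complex *)

Section Independence.
Variables (m : nat) (G : sgraph m).
Implicit Types (A B : {set 'I_m}).

Definition independent (A : {set 'I_m}) : bool :=
  [forall x in A, forall y in A, ~~ adj G x y].

Lemma independentP (A : {set 'I_m}) :
  reflect {in A &, forall x y, ~~ adj G x y} (independent A).
Proof.
apply: (iffP 'forall_in_forall_inP) => [iA x y xA yA|iA x xA y yA]; exact: iA.
Qed.

Lemma independentS (A B : {set 'I_m}) : A \subset B -> independent B -> independent A.
Proof.
move=> /subsetP sAB /independentP iB; apply/independentP=> x y /sAB xB /sAB yB.
exact: iB.
Qed.

Lemma independent_set1 x : independent [set x].
Proof.
by apply/independentP=> y z /set1P-> /set1P->; rewrite adj_irrefl.
Qed.

Lemma independent_set0 : independent set0.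
Proof. by apply/independentP=> x y; rewrite inE. Qed.

Lemma independentU1 x (A : {set 'I_m}) :
  independent A -> (forall y, y \in A -> ~~ adj G x y) -> independent (x |: A).
Proof.
move=> /independentP iA xA; apply/independentP=> y z /setU1P[->|yA] /setU1P[->|zA].
- by rewrite adj_irrefl.
- exact: xA.
- by rewrite adj_sym; apply: xA.
- exact: iA.
Qed.

End Independence.

(** * Monomials and their supports *)

Section Monomials.
Variables (m : nat).
Implicit Types (A : {set 'I_m}) (u v : 'X_{1..m}).

Definition mnm_support (u : 'X_{1..m}) : {set 'I_m} := [set i | u i != 0%N].

Definition mnm_set (A : {set 'I_m}) : 'X_{1..m} := [multinom (i \in A : nat) | i < m].

Lemma mnm_setE A i : mnm_set A i = (i \in A).
Proof. by rewrite mnmE. Qed.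

Lemma mnm_supportK A : mnm_support (mnm_set A) = A.
Proof. by apply/setP=> i; rewrite inE mnm_setE; case: (i \in A). Qed.

Lemma mnm_setD1 A i : i \in A -> mnm_set A = (mnm_set (A :\ i) + U_(i))%MM.
Proof.
move=> iA; apply/mnmP=> j; rewrite mnmDE !mnm_setE mnm1E !inE (eq_sym i).
by case: (eqVneq j i) => [->|]; rewrite ?iA ?addn0.
Qed.

Lemma mnm_support_subS u v : (u <= v)%MM -> mnm_support u \subset mnm_support v.
Proof.
move=> /mnm_lepP uv; apply/subsetP=> i; rewrite !inE -!lt0n => ui.
exact: leq_trans ui (uv i).
Qed.

Lemma mcoeffMXE (R : comNzRingType) (p : {mpoly R[m]}) u v :
  (p * 'X_[u])@_v = if (u <= v)%MM then p@_(v - u) else 0.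
Proof.
case: ifPn => [uv|uv]; first by rewrite -{1}(submK uv) addmC mcoeffMX.
apply: memN_msupp_eq0; rewrite (perm_mem (msuppMX p u)).
by apply: contra uv => /mapP[w _ ->]; rewrite lem_addr.
Qed.

End Monomials.

(** * Membership in the edge ideal *)

Section EdgeIdealTheory.
Variables (k : fieldType) (m : nat) (G : sgraph m).
Local Notation P := {mpoly k[m]}.
Local Notation I := (@edge_ideal k m G).

Lemma edge_mem x y (p : P) : adj G x y -> p * ('X_x * 'X_y) \in I.
Proof.
move=> axy; rewrite idealMr //; apply/asboolP.
have xyg : 'X_x * 'X_y \in edge_gens k G.
  by apply/mapP; exists (x, y); rewrite ?mem_enum.
have lt_ix := xyg; rewrite -index_mem in lt_ix.
exists (fun i => (i == index ('X_x * 'X_y : P) (edge_gens k G))%:R).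
rewrite (bigD1 (Ordinal lt_ix)) //= eqxx mul1r nth_index // big1 ?addr0 // => i.
by rewrite -val_eqE /= => /negPf->; rewrite mul0r.
Qed.

(** The ideal is spanned by the monomials divisible by some [X_x X_y] with [x], [y] adjacent, that
    is, those with dependent support. Membership thus becomes a test on single coefficients. *)
Lemma edge_ideal_mcoeff (p : P) :
  p \in I <-> forall u, independent G (mnm_support u) -> p@_u = 0.
Proof.
split=> [/asboolP[c ->] u /independentP iu|p0].
  rewrite raddf_sum big1 //= => i _.
  have /mapP[[x y] /=] := mem_nth 0 (ltn_ord i); rewrite mem_enum => axy ->.
  rewrite -mpolyXD mcoeffMXE; case: ifP => // /mnm_lepP le_u.
  suff: ~~ adj G x y by rewrite [adj G x y]axy.
  apply: iu.
    by rewrite inE -lt0n (leq_trans _ (le_u x)) // mnmDE mnm1E eqxx.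
  by rewrite inE -lt0n (leq_trans _ (le_u y)) // mnmDE !mnm1E eqxx addn1.
rewrite [p]mpolyE rpred_sum // => u _.
have [/p0->|] := boolP (independent G (mnm_support u)).
  by rewrite scale0r rpred0.
rewrite /independent negb_forall_in => /exists_inP[x xu].
rewrite negb_forall_in => /exists_inP[y yu]; rewrite negbK => axy.
have xy : x != y by apply: contraTneq axy => ->; rewrite adj_irrefl.
have le_u : (U_(x) + U_(y) <= u)%MM.
  apply/mnm_lepP=> z; rewrite mnmDE !mnm1E; move: xu yu; rewrite !inE -!lt0n.
  case: (eqVneq x z) => [<-|_]; first by rewrite eq_sym (negPf xy).
  by case: (eqVneq y z) => [<-|].
by rewrite -(submK le_u) mpolyXD scalerAl mpolyXD edge_mem.
Qed.

Definition edge_pi : {rmorphism P -> edge_ring k G} := \pi_{ideal_quot I}%qT.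

Lemma edge_pi_eq0 (p : P) : edge_pi p = 0 <-> p \in I.
Proof.
by rewrite -[p in p \in _]subr0 Quotient.idealrBE raddf0; split=> /eqP.
Qed.

Lemma edge_pi_surj (z : edge_ring k G) : exists p, edge_pi p = z.
Proof. by exists (repr (z : {ideal_quot I})%qT); rewrite /edge_pi /= reprK. Qed.

Lemma edge_module_scale (a p : P) :
  a *: (edge_pi p : edge_module k G) = edge_pi (a * p).
Proof. by rewrite rmorphM. Qed.

End EdgeIdealTheory.

(** * Upper bounds for the depth *)

Section DepthBound.
Variables (k : fieldType) (m : nat) (G : sgraph m).
Local Notation P := {mpoly k[m]}.

Lemma max_idealP (f : P) :
  max_ideal f <-> exists a : 'I_m -> P, f = \sum_x a x * 'X_x.
Proof.
have sz : size [seq 'X_i : P | i <- enum 'I_m] = m by rewrite size_map size_enum_ord.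
have gE (i : 'I_m) : [seq 'X_i : P | i <- enum 'I_m]`_i = 'X_i.
  by rewrite (nth_map i) ?size_enum_ord // nth_ord_enum.
split=> [[c ->]|[a ->]].
  exists (fun i => c i); rewrite sz.
  by apply: eq_bigr => i _; rewrite gE.
exists (fun n => oapp a 0 (insub n : option 'I_m)); rewrite sz.
by apply: eq_bigr => i _; rewrite gE valK.
Qed.

(* The nilpotent elements modulo (X_x^(t x)) form an ideal. *)
Lemma max_ideal_nilpotent (t : 'I_m -> nat) (f : P) : max_ideal f ->
  exists N (a : 'I_m -> P), f ^+ N = \sum_x a x * 'X_x ^+ t x.
Proof.
move=> /max_idealP[c ->].
pose nilp (g : P) := exists N (a : 'I_m -> P), g ^+ N = \sum_x a x * 'X_x ^+ t x.
pose J (g : P) := exists a : 'I_m -> P, g = \sum_x a x * 'X_x ^+ t x.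
have JM g h : J h -> J (g * h).
  move=> [a ->]; exists (fun x => g * a x).
  by rewrite mulr_sumr; apply: eq_bigr => x _; rewrite mulrA.
have JD g h : J g -> J h -> J (g + h).
  move=> [a ->] [b ->]; exists (fun x => a x + b x).
  by rewrite -big_split /=; apply: eq_bigr => x _; rewrite mulrDl.
have J0 : J 0 by exists (fun=> 0); rewrite big1 // => x _; rewrite mul0r.
have nilpD g h : nilp g -> nilp h -> nilp (g + h).
  (* Each binomial term contains [g] at least [N] times or [h] at least [N'] times. *)
  move=> [N gN] [N' hN]; exists (N + N')%N; rewrite exprDn.
  apply: (big_ind J) => // i _; rewrite -mulr_natr mulrC; apply: (JM).

  have [le_iN|lt_Ni] := leqP i N'.
    by rewrite -addnBA // addnC exprD -mulrA [_ * h ^+ i]mulrC mulrA; apply: JM.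
  by rewrite -[X in h ^+ X](subnK (ltnW lt_Ni)) exprD mulrA; apply: JM.
have nilpM x g : nilp (g * 'X_x).
  exists (t x), (fun z => (z == x)%:R * g ^+ t x).
  rewrite (bigD1 x) //= eqxx mul1r exprMn big1 ?addr0 // => z /negPf->.
  by rewrite !mul0r.
apply: (big_ind nilp) => //; exists 1%N; exact: J0.
Qed.

Local Notation r := (@nat_of_ord m).

Implicit Types (A B : {set 'I_m}).

Section Cochain.
Variables (F : {set 'I_m}) (d : nat) (phi : {set 'I_m} -> k).
Hypothesis phi_cocycle : forall A, F \subset A -> independent G A ->
  #|A| = d.+1 -> \sum_(x in A :\: F) ksign r k x A * phi (A :\ x) = 0.

(** The exponent is 2 on [F], so that multiplying by [X_x ^+ t x] with [x] in [F] never reaches a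
    squarefree monomial, and 1 elsewhere. *)
Let t (x : 'I_m) : nat := (x \in F).+1.
Let C A : P := if [&& F \subset A, independent G A & #|A| == d]
  then phi A *: 'X_[mnm_set A] else 0.

Lemma ksignC x (A : {set 'I_m}) : ksign r P x A = (ksign r k x A)%:MP.
Proof. by rewrite /ksign rmorphXn rmorphN rmorph1. Qed.

(* The cochain C lies in the multigraded component of the Koszul complex of the
   powers X_x^(t x) in which the monomial attached to A is X_A for A containing
   F; this component is the cochain complex of the link of F in the independence
   complex. *)
Lemma depth_bound s :
  (forall f : P, f \in s -> max_ideal f) ->
  regular_sequence (edge_module k G) s ->
  (forall psi : {set 'I_m} -> k, ~ forall A, F \subset A -> independent G A ->
     #|A| = d -> phi A = \sum_(x in A :\: F) ksign r k x A * psi (A :\ x)) ->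
  (size s <= d)%N.
Proof.
move=> sJ [s_reg _] not_cob; rewrite leqNgt; apply/negP=> lt_ds.
pose y x : P := 'X_x ^+ t x.
pose c A : edge_module k G := edge_pi k G (C A).
have kdE (g : {set 'I_m} -> P) A :
  kdiff r y (fun B => edge_pi k G (g B) : edge_module k G) A
  = edge_pi k G (\sum_(x in A) (ksign r P x A * y x) * g (A :\ x)).
  by rewrite raddf_sum; apply: eq_bigr => x _; rewrite edge_module_scale.
have c_hom : homogeneous_cochain d c.
  by move=> A /negPf nA; rewrite /c /C nA !andbF raddf0.
have c_cocycle A : kdiff r y c A = 0.
  rewrite kdE; apply/edge_pi_eq0/edge_ideal_mcoeff => u iu.
  rewrite raddf_sum /=.
  have [sFA|nFA] := boolP (F \subset A); last first.
    apply: big1 => x xA; rewrite /C ifF ?mulr0 ?mcoeff0 //; apply: contraNF nFA.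
    by case/and3P=> sFA _ _; apply: subset_trans sFA (subsetDl _ _).
  have [/eqP cA|nA] := boolP (#|A| == d.+1); last first.
    apply: big1 => x xA; rewrite /C ifF ?mulr0 ?mcoeff0 //; apply: contraNF nA.
    by case/and3P=> _ _ /eqP <-; rewrite (cardsD1 x A) xA.
  (* Removing [x] outside [F] and multiplying by [X_x] gives back the monomial of [A]; no other
     coefficient occurs. *)
  have [uA|uA] := eqVneq (mnm_set A) u; last first.
    apply: big1 => x xA; rewrite /C; case: ifP; rewrite ?mulr0 ?mcoeff0 //.
    case/and3P=> sFAx _ _; rewrite ksignC -mulrA mcoeffCM -scalerAr mcoeffZ.
    have xF : x \notin F.
      by apply: contraTN sFAx => xF; apply/subsetPn; exists x; rewrite // !inE eqxx.
    rewrite /y /t (negPf xF) expr1 -mpolyXD mcoeffX addmC -mnm_setD1 // (negPf uA).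
    by rewrite !mulr0.
  rewrite -uA mnm_supportK in iu.
  apply: etrans (phi_cocycle sFA iu cA).
  rewrite (bigID (mem F)) /= big1 ?add0r => [|x /andP[xA xF]]; last first.
    rewrite /C ifF ?mulr0 ?mcoeff0 //; apply/negP=> /and3P[/subsetP/(_ x xF)].
    by rewrite !inE eqxx.
  apply: eq_big => [x|x /andP[xA xF]]; first by rewrite !inE andbC.
  rewrite /C ifT; last first.
    rewrite (independentS _ iu) ?subsetDl // subsetD1 sFA xF /=.
    by move/eqP: cA; rewrite (cardsD1 x A) xA add1n eqSS.
  rewrite ksignC -mulrA mcoeffCM -scalerAr mcoeffZ /y /t (negPf xF) expr1.
  by rewrite -mpolyXD mcoeffX addmC -mnm_setD1 // uA eqxx mulr1.
have s_nilp f : f \in s -> exists N (a : 'I_m -> P), f ^+ N = \sum_x a x * y x.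
  by move=> /sJ/max_ideal_nilpotent; apply.
have [g gE] := kcocycle_coboundary (@ord_inj m) s_reg s_nilp lt_ds c_hom c_cocycle.
have /choice[h hE] : forall A, exists p, edge_pi k G p = g A.
  by move=> A; apply: edge_pi_surj.
(* A primitive of [c] yields one of [phi]: lift its values to polynomials and read off the
   squarefree coefficients. *)
apply: (not_cob (fun A => (h A)@_(mnm_set A))) => A sFA iA cA.
have := gE A; rewrite (_ : g = fun B => edge_pi k G (h B)); last exact/funext.
rewrite kdE => /eqP; rewrite -subr_eq0 -raddfB => /eqP/edge_pi_eq0.
move/edge_ideal_mcoeff/(_ (mnm_set A)); rewrite mnm_supportK => /(_ iA).
rewrite mcoeffB /C sFA iA cA eqxx mcoeffZ mcoeffX eqxx mulr1 => /eqP.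
rewrite subr_eq0 raddf_sum => /eqP ->; rewrite (bigID (mem F)) /=.
rewrite big1 ?add0r => [|x /andP[xA xF]]; last first.
  rewrite ksignC -mulrA mcoeffCM /y /t xF ['X_x ^+ _ * _]mulrC mpolyXn mcoeffMXE.
  rewrite ifF ?mulr0 //; apply/negP=> /mnm_lepP/(_ x).
  by rewrite mulmnE mnm1E eqxx mnm_setE xA.
apply: eq_big => [x|x /andP[xA xF]]; first by rewrite !inE andbC.
rewrite ksignC -mulrA mcoeffCM /y /t (negPf xF) expr1 ['X_x * _]mulrC.
by rewrite (mnm_setD1 xA) addmC mcoeffMX.
Qed.

End Cochain.

(** The link of a facet is the empty simplex alone: the constant 1 is a cocycle since no face
    properly contains [F], and a coboundary at [F] is an empty sum. *)
Lemma depth_le_facet F s :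
  independent G F -> (forall x, x \notin F -> exists2 y, y \in F & adj G x y) ->
  (forall f : P, f \in s -> max_ideal f) ->
  regular_sequence (edge_module k G) s -> (size s <= #|F|)%N.
Proof.
move=> iF Fmax sJ s_reg; apply: (@depth_bound F _ (fun=> 1)) sJ s_reg _.
  move=> A sFA /independentP iA cA.
  have /properP[_ [x xA xF]] : F \proper A.
    by rewrite properEcard sFA cA ltnS leqnn.
  have [y yF axy] := Fmax x xF.
  by have := iA x y xA (subsetP sFA y yF); rewrite [adj G x y]axy.
move=> psi /(_ F (subxx _) iF erefl)/eqP; rewrite setDv big_set0.
by rewrite oner_eq0.
Qed.

Lemma ksign0 i : ksign r k i set0 = 1.
Proof. by rewrite /ksign eq_card0 // => j; rewrite !inE. Qed.

Lemma ksign1 i j : ksign r k i [set j] = (-1) ^+ (j < i)%N.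
Proof. by rewrite -[[set j]]setU0 ksignU1 ?inE // ksign0 mulr1. Qed.

(** The predicate [p] is a locally constant function on the vertices of the independence complex,
    whereas coboundaries of the empty face are constant. *)
Lemma depth_le1 (p : pred 'I_m) a b s :
  (forall x y, x != y -> ~~ adj G x y -> p x = p y) -> p a -> ~~ p b ->
  (forall f : P, f \in s -> max_ideal f) ->
  regular_sequence (edge_module k G) s -> (size s <= 1)%N.
Proof.
move=> pE pa pb sJ s_reg.
apply: (@depth_bound set0 _ (fun A => [exists x in A, p x]%:R)) sJ s_reg _.
  have p1 x : [exists z in [set x], p z] = p x.
    by apply/exists_inP/idP => [[z /set1P->]|px] //; exists x; rewrite ?inE.
  move=> A _ /independentP iA /eqP/cards2P[x [y [xy AE]]].
  have pxy : p x = p y by apply: pE => //; apply: iA; rewrite AE !inE eqxx ?orbT.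
  rewrite setD0 AE big_setU1 ?inE //= big_set1 setU1K ?inE //.
  have -> : (x |: [set y]) :\ y = [set x] by rewrite setUC setU1K // inE eq_sym.
  rewrite !p1 pxy -mulrDl !ksignU1 ?inE // !ksign1 !ltnn !mul1r mulr1.
  by rewrite (sign_ltn_anti (@ord_inj m) _ xy) addrN mul0r.
move=> psi psiE.
have psi1 x : [exists z in [set x], p z]%:R = psi set0.
  rewrite psiE ?sub0set ?independent_set1 ?cards1 // setD0 big_set1 setDv.
  by rewrite -[[set x]]setU0 ksignU1_id ?inE // ksign0 mul1r.
have := psi1 b; rewrite -(psi1 a) => /eqP; apply/negP.
have -> : [exists z in [set a], p z] by apply/exists_inP; exists a; rewrite ?inE.
have -> : [exists z in [set b], p z] = false.
  by apply/exists_inP=> -[z /set1P->]; apply/negP.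
by rewrite eq_sym oner_eq0.
Qed.

(** Here [w] is a 1-cocycle of the independence complex on oriented edges; [phi] evaluates it on the
    increasing orientation. *)
Lemma depth_le2 (w : 'I_m -> 'I_m -> k) s :
  (forall x y, w y x = - w x y) ->
  (forall x y z, uniq [:: x; y; z] -> ~~ adj G x y -> ~~ adj G y z ->
     ~~ adj G x z -> w x y + w y z + w z x = 0) ->
  (forall psi : 'I_m -> k, ~ forall x y, x != y -> ~~ adj G x y ->
     w x y = psi y - psi x) ->
  (forall f : P, f \in s -> max_ideal f) ->
  regular_sequence (edge_module k G) s -> (size s <= 2)%N.
Proof.
move=> wC w3 wN sJ s_reg.
pose phi A : k := \sum_(x in A) \sum_(y in A | (x < y)%N) w x y.
have phi2 (x y : 'I_m) : (x < y)%N -> phi (x |: [set y]) = w x y.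
  move=> xy; have nxy : x != y by apply: contraTneq xy => ->; rewrite ltnn.
  rewrite /phi big_setU1 ?inE //= big_set1 [X in _ + X]big_pred0 ?addr0; last first.
    move=> z; rewrite !inE; apply/negP=> /andP[/orP[]/eqP->]; rewrite ?ltnn //.
    by rewrite ltnNge ltnW.
  rewrite (big_pred1 y) // => z; rewrite !inE.
  case: (eqVneq z y) => [->|_]; first by rewrite orbT.
  by case: eqP => [->|]; rewrite ?ltnn.
apply: (@depth_bound set0 _ phi) sJ s_reg _.
  move=> A _ /independentP iA A3; rewrite setD0.
  have [x0 x0A] : exists x, x \in A by apply/set0Pn; rewrite -card_gt0 A3.
  (* The triangle is sorted as [x < y < z], which fixes all signs. *)
  case: (arg_minnP (@nat_of_ord m) x0A) => x; rewrite -/(x \in A) => xA xmin.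
  have /eqP/cards2P[y0 [z0 [yz0 Axy]]] : #|A :\ x| = 2.
    by move: A3; rewrite (cardsD1 x A) xA add1n => -[].
  have [y [z [yz {}Axy]]] : exists y z : 'I_m, (y < z)%N /\ A :\ x = [set y; z].
    have := yz0; rewrite -(inj_eq (@ord_inj m)) neq_ltn => /orP[yz|zy].
      by exists y0, z0.
    by exists z0, y0; rewrite setUC.
  have AE : A = x |: (y |: [set z]) by rewrite -Axy setD1K.
  have nyz : y != z by apply: contraTneq yz => ->; rewrite ltnn.
  have /setD1P[nyx yA] : y \in A :\ x by rewrite Axy !inE eqxx.
  have /setD1P[nzx zA] : z \in A :\ x by rewrite Axy !inE eqxx orbT.
  have xy : (x < y)%N.
    by rewrite ltn_neqAle xmin // andbT (inj_eq (@ord_inj m)) eq_sym.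
  have xz := ltn_trans xy yz.
  have D1 : A :\ x = y |: [set z] by [].
  have D2 : A :\ y = x |: [set z].
    apply/setP=> v; rewrite AE !inE; case: (eqVneq v y) => [->|] //=.
    by rewrite (negPf nyx) (negPf nyz).
  have D3 : A :\ z = x |: [set y].
    apply/setP=> v; rewrite AE !inE; case: (eqVneq v z) => [->|] //=.
      by rewrite (negPf nzx) eq_sym (negPf nyz).
    by rewrite orbF.
  rewrite (big_setD1 x) //= D1 big_setU1 ?inE //= big_set1 D2 D3 !phi2 //.
  have [nxy nxz] : x != y /\ x != z by rewrite !(eq_sym x).
  rewrite AE !ksignU1 ?inE ?negb_or ?nxy ?nxz //.
  rewrite !ksign1 !ltnn xy xz yz !ltnNge !(ltnW xy) !(ltnW xz) !(ltnW yz) /=.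
  have := w3 x y z; rewrite /= !inE negb_or nxy nxz nyz.
  move=> /(_ isT); rewrite !iA // => /(_ isT isT isT) <-.
  by rewrite (wC x z); ring.
move=> psi psiE; apply: (wN (fun x => psi [set x])) => x y.
wlog xy : x y / (x < y)%N => [hw nxy axy|].
  have := nxy; rewrite -(inj_eq (@ord_inj m)) neq_ltn => /orP[]ltxy; first exact: hw.
  by rewrite wC (hw y x) 1?eq_sym 1?adj_sym ?opprB.
move=> nxy axy; rewrite -phi2 // psiE ?sub0set //; last first.
- by rewrite cardsU1 cards1 inE nxy.
- by apply: independentU1 => [|z /set1P->] //; apply: independent_set1.
rewrite setD0 big_setU1 ?inE //= big_set1 setU1K ?inE //.
have -> : (x |: [set y]) :\ y = [set x] by rewrite setUC setU1K // inE eq_sym.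
rewrite !ksignU1 ?inE // !ksign1 !ltnn xy ltnNge ltnW //=.
by ring.
Qed.

End DepthBound.

(** * Restriction to a subset of the variables *)

Section Restriction.
Variables (k : fieldType) (m : nat).
Local Notation P := {mpoly k[m]}.
Implicit Types (A B : {set 'I_m}) (p q : P).

(** The polynomials fixed by this retraction form the subring [k[A]], which thereby stays inside the
    one ring [P]. *)
Definition mrestrict A : {rmorphism P -> P} :=
  comp_mpoly [tuple (if i \in A then 'X_i else 0 : P) | i < m].

Lemma mrestrictE A p u :
  (mrestrict A p)@_u = if mnm_support u \subset A then p@_u else 0.
Proof.
have XE v : mrestrict A 'X_[v] = if mnm_support v \subset A then 'X_[v] else 0.
  rewrite /mrestrict /= comp_mpolyX; case: ifP => [/subsetP sA|/negP/negP].
    rewrite [RHS]mpolyXE_id; apply: eq_bigr => i _; rewrite tnth_mktuple.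
    case: ifPn => // iA; case: (eqVneq (v i) 0%N) => [->|vi] //.
    by rewrite sA ?inE // in iA.
  case/subsetPn=> i; rewrite inE => vi iA.
  by rewrite (bigD1 i) //= tnth_mktuple (negPf iA) expr0n (negPf vi) mul0r.
rewrite {1}[p]mpolyE rmorph_sum raddf_sum /=.
under eq_bigr => v _ do rewrite -mul_mpolyC rmorphM /= [mrestrict A _]comp_mpolyC
  mcoeffCM XE (fun_if (mcoeff u)) mcoeff0 mcoeffX.
rewrite [p in RHS]mpolyE raddf_sum /=.
have [sA|nA] := ifP.
  apply: eq_bigr => v _; rewrite mcoeffZ mcoeffX.
  case: (eqVneq v u) => [->|]; first by rewrite sA.
  by rewrite mulr0; case: ifP => _; rewrite mulr0.
apply: big1 => v _; case: (eqVneq v u) => [->|]; first by rewrite nA mulr0.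
by case: ifP => _; rewrite mulr0.
Qed.

Lemma mrestrict_comp A B p : mrestrict A (mrestrict B p) = mrestrict (A :&: B) p.
Proof.
by apply/mpolyP=> u; rewrite !mrestrictE subsetI; case: ifP => //= _; case: ifP.
Qed.

Lemma mrestrictX A x : mrestrict A 'X_x = if x \in A then 'X_x else 0.
Proof. by rewrite /mrestrict /= comp_mpolyXU -tnth_nth tnth_mktuple. Qed.

Lemma mpolyX_neq0 x : 'X_x != 0 :> P.
Proof.
apply/eqP=> /(congr1 (mcoeff U_(x))); rewrite mcoeffXU eqxx mcoeff0 => /eqP.
by rewrite oner_eq0.
Qed.

End Restriction.

(** * Algebraic independence modulo a prime ideal *)

Section AlgebraicIndependence.
Variables (k : fieldType) (m : nat).
Local Notation P := {mpoly k[m]}.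

(** The kernel of [chi] meets [k[T]] only in 0. *)
Definition alg_independent (K : comNzRingType) (chi : {rmorphism P -> K})
    (T : {set 'I_m}) : Prop :=
  forall p, chi (mrestrict k T p) = 0 -> mrestrict k T p = 0.

(** As [z] is a nonzerodivisor, factors [X] can be cancelled from [F] until its constant term is
    nonzero; all other terms are then multiples of [z]. *)
Lemma root_low_coef (K : comNzRingType) (z : K) (F : {poly K}) :
  (forall h, h * z = 0 -> h = 0) -> F != 0 -> root F z ->
  exists j h, F`_j != 0 /\ F`_j + h * z = 0.
Proof.
move=> zreg; elim/poly_ind: F => [|F c IHF]; first by rewrite eqxx.
have [->|c0] := eqVneq c 0; rewrite /root hornerMXaddC; last first.
  move=> _ /eqP Fz; exists 0%N, F.[z].
  by rewrite coefD coefMX coefC add0r addrC.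
rewrite !addr0 => F0 /eqP/zreg/eqP Fz.
have {}F0 : F != 0 by apply: contraNneq F0 => ->; rewrite mul0r.
have [j [h [Fj Fh]]] := IHF F0 Fz; exists j.+1, h.
by rewrite coefMX.
Qed.

Section Step.
Variables (K K' : comNzRingType).
Variables (chi : {rmorphism P -> K}) (chi' : {rmorphism P -> K'}).
Hypothesis chi_surj : forall z, exists p, chi p = z.
Hypothesis K_domain : forall z w : K, z * w = 0 -> z = 0 \/ w = 0.
Hypothesis chi_ker : forall p, chi p = 0 -> chi' p = 0.
Variable T : {set 'I_m}.
Hypothesis T_indep : alg_independent chi' T.

Let tau : {rmorphism P -> K} := chi \o mrestrict k T.

Lemma tau_fixed p : mrestrict k T p = p -> tau p = chi p.
Proof. by rewrite /tau /= => ->. Qed.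

Lemma tau_eq0 p : tau p = 0 -> mrestrict k T p = 0.
Proof. by move=> /chi_ker/T_indep. Qed.

(** The coefficient of [X_v ^+ j] when [p] is read as a polynomial in [X_v] over the other
    variables. *)
Definition mcoef_in (v : 'I_m) (j : nat) (p : P) : P :=
  \sum_(u <- msupp p | u v == j) p@_u *: 'X_[u - U_(v) *+ j].

Lemma mcoef_inE v (p : P) D : (forall u, u \in msupp p -> (u v < D)%N) ->
  p = \sum_(j < D) mcoef_in v j p * 'X_v ^+ j.
Proof.
move=> ltD; rewrite {1}[p]mpolyE.
under [RHS]eq_bigr => j _ do rewrite mulr_suml.
rewrite (exchange_big_dep predT) //= big_seq [RHS]big_seq.
apply: eq_bigr => u uP; rewrite (big_pred1 (Ordinal (ltD u uP))) /= => [|j].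
  rewrite mpolyXn -scalerAl -mpolyXD submK //; apply/mnm_lepP=> i.
  by rewrite mulmnE mnm1E; case: eqP => [->|]; rewrite ?mul1n ?mul0n.
by rewrite /= -val_eqE eq_sym.
Qed.

Lemma mcoef_in_mcoeff v j (p : P) (u : 'X_{1..m}) : u v = 0%N ->
  (mcoef_in v j p)@_u = p@_(u + U_(v) *+ j).
Proof.
move=> uv; rewrite [p in RHS]mpolyE !raddf_sum /=.
rewrite [RHS](bigID (fun w : 'X_{1..m} => w v == j)) /=.
rewrite [X in _ + X]big1 ?addr0 => [|w wj]; last first.
  rewrite mcoeffZ mcoeffX; case: eqP => [wE|]; last by rewrite mulr0.
  by rewrite wE mnmDE uv mulmnE mnm1E eqxx mul1n add0n eqxx in wj.
apply: eq_bigr => w /eqP wj; rewrite !mcoeffZ !mcoeffX; congr (_ * _%:R).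
have le_w : (U_(v) *+ j <= w)%MM.
  apply/mnm_lepP=> i; rewrite mulmnE mnm1E.
  by case: eqP => [<-|]; rewrite ?wj ?mul1n ?mul0n.
congr (nat_of_bool _); apply/eqP/eqP=> [<-|->]; first by rewrite submK.
by rewrite addmK.
Qed.

(** A relation [q] in [k[v, T]], read as a polynomial in [X_v] over [k[T]], makes [X_v] integral
    after multiplication by its leading coefficient [a]. *)
Lemma algebraic_variable v : v \notin T -> ~ alg_independent chi (v |: T) ->
  exists a, [/\ mrestrict k T a = a, a != 0 & integralOver tau (chi (a * 'X_v))].
Proof.
move=> vT /existsNP[p /not_implyP[chi_q /eqP q0]].
move: (mrestrict k (v |: T) p) chi_q q0 (mrestrictE (v |: T) p) => q chi_q q0 qE.
have [D [u uq uD] ltD] : exists2 D, exists2 u, u \in msupp q & u v = D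
    & forall u, u \in msupp q -> (u v < D.+1)%N.
  pose E n := has (fun u : 'X_{1..m} => u v == n) (msupp q).
  have exE : exists n, E n.
    case Eq : (msupp q) => [|u l]; first by rewrite -msupp_eq0 Eq in q0.
    by exists (u v); rewrite /E Eq /= eqxx.
  have bE n : E n -> (n <= \max_(u <- msupp q) u v)%N.
    move=> /hasP[u uq /eqP <-].
    exact: (@leq_bigmax_seq _ _ xpredT (fun u : 'X_{1..m} => u v)).
  case: (ex_maxnP exE bE) => D /hasP[u uq /eqP uD] Dmax; exists D; first by exists u.
  by move=> w wq; apply: Dmax; apply/hasP; exists w.
have q_T j : mrestrict k T (mcoef_in v j q) = mcoef_in v j q.
  apply/mpolyP=> w; rewrite mrestrictE; case: ifPn => // /subsetPn[i iw iT].
  have [wv|wv] := eqVneq (w v) 0%N.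
    rewrite mcoef_in_mcoeff // qE ifF //; apply/negP=> /subsetP/(_ i).
    move: iw; rewrite !inE mnmDE (negPf iT) => iw.
    rewrite addn_eq0 negb_and iw => /(_ isT); rewrite orbF => /eqP iv.
    by rewrite iv wv in iw.
  symmetry; apply: memN_msupp_eq0; apply/negP.
  rewrite mcoeff_msupp /mcoef_in raddf_sum /= big1 ?eqxx // => w' /eqP wj.
  rewrite mcoeffZ mcoeffX; case: eqP => [ww|]; last by rewrite mulr0.
  by rewrite -ww mnmBE mulmnE mnm1E eqxx mul1n wj subnn eqxx in wv.
exists (mcoef_in v D q); split; first exact: q_T.
  apply/eqP=> /(congr1 (mcoeff (u - U_(v) *+ D))); rewrite mcoeff0.
  rewrite mcoef_in_mcoeff ?submK; last by rewrite mnmBE mulmnE mnm1E eqxx mul1n uD subnn.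
    by apply/eqP; rewrite -mcoeff_msupp.
  apply/mnm_lepP=> i; rewrite mulmnE mnm1E.
  by case: eqP => [<-|]; rewrite ?uD ?mul1n ?mul0n.
(* With a the leading coefficient of q in X_v, this is the usual monic equation
   of a X_v multiplied by the unknown, so that D = 0 needs no special case. *)
set a := mcoef_in v D q.
pose g := \sum_(j < D) (mcoef_in v j q * a ^+ (D.-1 - j)) *: 'X^(j.+1) : {poly P}.
pose f : {poly P} := 'X^(D.+1) + g.
have sz_g : (size g <= D.+1)%N.
  apply: (leq_trans (size_sum _ _ _)); apply/bigmax_leqP => j _.
  by rewrite (leq_trans (size_scale_leq _ _)) // size_polyXn ltnS.
exists f.
  by rewrite monicE lead_coefDl ?size_polyXn // lead_coefXn.
have a_T : mrestrict k T a = a by apply: q_T.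
rewrite /root /f rmorphD /= map_polyXn hornerD hornerXn rmorph_sum /= horner_sum.
have tauE (j : 'I_D) :
  (map_poly tau ((mcoef_in v j q * a ^+ (D.-1 - j)) *: 'X^(j.+1))).[chi (a * 'X_v)]
  = chi (mcoef_in v j q) * chi a ^+ (D.-1 - j) * (chi a * chi 'X_v) ^+ j.+1.
  rewrite map_polyZ map_polyXn hornerZ hornerXn tau_fixed ?rmorphM ?rmorphXn ?q_T ?a_T //.
under eq_bigr => j _ do rewrite tauE.
have chi_qE : chi q = chi a * chi 'X_v ^+ D
                      + \sum_(j < D) chi (mcoef_in v j q) * chi 'X_v ^+ j.
  rewrite {1}(mcoef_inE ltD) rmorph_sum big_ord_recr /= addrC rmorphM rmorphXn.
  by congr (_ + _); apply: eq_bigr => j _; rewrite rmorphM rmorphXn.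
(* The monic equation at [a X_v] is [a ^+ D * X_v] times the relation [q]. *)
apply/eqP; transitivity (chi a ^+ D * chi 'X_v * chi q); last by rewrite chi_q mulr0.
rewrite chi_qE mulrDr mulr_sumr; congr (_ + _).
  by rewrite rmorphM exprMn !exprS; ring.
apply: eq_bigr => j _; rewrite exprMn.
have -> : chi a ^+ D = chi a ^+ (D.-1 - j) * chi a ^+ j.+1.
  by rewrite -exprD; congr (_ ^+ _); have := ltn_ord j; lia.
by rewrite [chi 'X_v ^+ j.+1]exprS; ring.
Qed.

Lemma chi_neq0X p N : chi p <> 0 -> chi (p ^+ N) <> 0.
Proof.
move=> p0; elim: N => [|N IHN]; first by rewrite expr0 rmorph1; apply/eqP/oner_neq0.
by rewrite exprS rmorphM => /K_domain[].
Qed.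

(** With [b] the product of all denominators every [b X_x] is integral over [k[T]], hence so is
    [b ^+ d] times a monomial of degree [d]. *)
Lemma integral_scaled (a : 'I_m -> P) :
  (forall x, [/\ mrestrict k T (a x) = a x, chi (a x) <> 0
              & integralOver tau (chi (a x * 'X_x))]) ->
  exists2 b, chi b <> 0 & forall p, exists N, integralOver tau (chi (b ^+ N * p)).
Proof.
move=> aP; pose b := \prod_x a x.
have tau_int p : mrestrict k T p = p -> integralOver tau (chi p).
  by move=> /tau_fixed <-; apply: integral_id.
have b_T : mrestrict k T b = b.
  by rewrite rmorph_prod /=; apply: eq_bigr => x _; case: (aP x).
have bX x : integralOver tau (chi (b * 'X_x)).
  rewrite /b (bigD1 x) //= mulrAC rmorphM; apply: integral_mul.
    by case: (aP x).
  apply: tau_int; rewrite rmorph_prod /=.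
  by apply: eq_bigr => z _; case: (aP z).
exists b.
  rewrite /b; elim/big_rec: _ => [|x p _ p0]; first by rewrite rmorph1; apply/eqP/oner_neq0.
  by rewrite rmorphM => /K_domain[] //; case: (aP x).
have lift N N' p : (N <= N')%N ->
    integralOver tau (chi (b ^+ N * p)) -> integralOver tau (chi (b ^+ N' * p)).
  move=> /subnK <- ip; rewrite exprD -mulrA rmorphM; apply: integral_mul => //.
  by apply: tau_int; rewrite rmorphXn b_T.
elim/mpolyind => [|c u p _ _ [N ip]].
  by exists 0%N; rewrite mulr0 rmorph0; apply: integral0.
exists (N + mdeg u)%N; rewrite mulrDr rmorphD; apply: integral_add; last first.
  by apply: lift ip; rewrite leq_addr.
apply: (lift (mdeg u)); first by rewrite leq_addl.
rewrite -mul_mpolyC mulrCA rmorphM; apply: integral_mul.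
  by apply: tau_int; rewrite /mrestrict /= comp_mpolyC.
rewrite mpolyXE_id mdegE -prodrXr -big_split /= rmorph_prod.
elim/big_rec: _ => [|x z _ iz]; first exact: integral1.
apply: integral_mul iz; rewrite -exprMn rmorphXn.
elim: (u x) => [|n IHn]; first exact: integral1.
by rewrite exprS; apply: integral_mul.
Qed.

(* If T cannot be extended, a common multiple b of the denominators makes all
   b X_x, hence some b^N g, integral over k[T].  The lowest nonzero coefficient of
   the integral equation is a multiple of g modulo ker chi, so it lies in ker chi'
   and T is dependent there. *)
Lemma alg_independent_step : (exists2 p, chi' p = 0 & chi p <> 0) ->
  exists2 v, v \notin T & alg_independent chi (v |: T).
Proof.
move=> [g g' chi_g]; apply: contrapT => no_v.
have /choice[a aP] : forall x, exists a, [/\ mrestrict k T a = a, chi a <> 0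
    & integralOver tau (chi (a * 'X_x))].
  move=> x; have [xT|xT] := boolP (x \in T).
    exists 1; rewrite !rmorph1 mul1r; split=> //; first exact/eqP/oner_neq0.
    by rewrite -tau_fixed ?mrestrictX ?xT //; apply: integral_id.
  have [||a [a_T a0 ia]] := @algebraic_variable x; first exact: xT.
    by move=> iv; apply: no_v; exists x.
  exists a; split=> //; rewrite -tau_fixed // => /tau_eq0; rewrite a_T.
  exact/eqP.
have [b chi_b /(_ g)[N]] := integral_scaled aP.
set z := chi _ => -[f f_mon f_z].
have z_reg h : h * z = 0 -> h = 0.
  move=> /K_domain[] //; rewrite /z rmorphM => /K_domain[] //.
  by move=> /(chi_neq0X chi_b).
have f0 : map_poly tau f != 0 by apply/monic_neq0/monic_map.
have [j [h []]] := root_low_coef z_reg f0 f_z.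
have [q <-] := chi_surj h.
rewrite coef_map /z -rmorphM => /eqP fj0; rewrite /tau /= -rmorphD => /chi_ker.
rewrite rmorphD !rmorphM g' !mulr0 addr0 => /T_indep fj.
by apply: fj0; rewrite /tau /= fj rmorph0.
Qed.

End Step.
End AlgebraicIndependence.

(** * Chains of primes in the edge ring *)

Section KrullDim.
Variables (k : fieldType) (m : nat) (G : sgraph m).
Local Notation P := {mpoly k[m]}.

(** The proof is an argument so that the ideal structure can be attached to a bare predicate. *)
Definition ideal_of (A : comNzRingType) (Q : {pred A}) (_ : idealr_closed Q) :
  {pred A} := Q.
HB.instance Definition _ (A : comNzRingType) (Q : {pred A}) (HQ : idealr_closed Q) :=
  isIdealr.Build A (ideal_of HQ) HQ.

Lemma prime_residue_map (Q : {pred edge_ring k G}) :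
  idealr_closed Q -> prime_idealr_closed Q ->
  exists (K : comNzRingType) (chi : {rmorphism P -> K}),
    [/\ forall z, exists p, chi p = z,
        forall z w : K, z * w = 0 -> z = 0 \/ w = 0
      & forall p, chi p = 0 <-> edge_pi k G p \in Q].
Proof.
move=> HQ Qp; pose K : comNzRingType := {ideal_quot (ideal_of HQ)}.
pose pi : {rmorphism edge_ring k G -> K} := \pi_{ideal_quot (ideal_of HQ)}%qT.
have pi_eq0 z : pi z = 0 <-> z \in Q.
  rewrite -[z in z \in Q]subr0 -[_ \in Q]/(z - 0 \in ideal_of HQ).
  by rewrite Quotient.idealrBE raddf0; split=> /eqP.
have pi_surj z : exists p, pi (edge_pi k G p) = z.
  have [p pE] := edge_pi_surj (repr (z : {ideal_quot (ideal_of HQ)})%qT).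
  by exists p; rewrite pE /pi /= reprK.
exists K, (pi \o edge_pi k G); split=> //= [z w|p].
  have [p <-] := pi_surj z; have [q <-] := pi_surj w.
  by rewrite -rmorphM => /pi_eq0/Qp/orP[] /pi_eq0; [left|right].
exact: pi_eq0.
Qed.

(** Descending from the top prime, each strict inclusion adds a variable to an algebraically
    independent set. At the bottom this set contains no edge, because [X_x X_y] is 0 in the edge
    ring. *)
Lemma prime_chain_le d e :
  (forall T, independent G T -> (#|T| <= d)%N) ->
  prime_chain (edge_ring k G) e -> (e <= d)%N.
Proof.
move=> Gd [Q [Qprime Qlt]].
have step t : (t <= e)%N -> exists2 T : {set 'I_m}, (t <= #|T|)%N &
    forall p, edge_pi k G (mrestrict k T p) \in Q (e - t)%N -> mrestrict k T p = 0.
  elim: t => [|t IHt] le_te.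
    (* With no variables only constants remain, and a proper ideal contains no nonzero constant. *)
    exists set0 => // p; rewrite subn0 => Qp.
    have [[Q0 Q1 QD] _] := Qprime e (leqnn e).
    have pE : mrestrict k set0 p = (p@_0)%:MP.
      apply/mpolyP=> u; rewrite mrestrictE mcoeffC subset0.
      have -> : (mnm_support u == set0) = (u == 0%MM).
        apply/eqP/eqP=> [u0|->]; last first.
          by apply/setP=> i; rewrite !inE mnm0E eqxx.
        apply/mnmP=> i; have: i \in mnm_support u = false by rewrite u0 inE.
        by rewrite inE mnm0E => /negbFE/eqP.
      by case: eqP => [->|]; rewrite ?mulr1 ?mulr0.
    move: Qp; rewrite pE; have [->|p0] := eqVneq (p@_0) 0; first by rewrite mpolyC0.
    move=> Qp; case/negP: Q1.
    have := QD (edge_pi k G (p@_0)^-1%:MP) _ _ Qp Q0.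
    by rewrite addr0 -rmorphM -mpolyCM mulVf // mpolyC1 rmorph1.
  have [T leT Tind] := IHt (ltnW le_te).
  have lt_e : (e - t.+1 < e)%N by rewrite subnSK // leq_subr.
  have [sQ [z zQ' zQ]] := Qlt _ lt_e; rewrite subnSK // in sQ zQ'.
  have [HQ Qp] := Qprime _ (ltnW lt_e); have [HQ' Qp'] := Qprime _ (leq_subr t e).
  have [K [chi [chi_surj K_dom chiE]]] := prime_residue_map HQ Qp.
  have [K' [chi' [_ _ chiE']]] := prime_residue_map HQ' Qp'.
  have [g gz] := edge_pi_surj z.
  have [|p /chiE'/Tind //||v vT vT_ind] :=
    @alg_independent_step k m K K' chi chi' chi_surj K_dom _ T.
  - by move=> p /chiE/sQ/chiE'.
  - by exists g; [apply/chiE'; rewrite gz|move/chiE; rewrite gz; apply/negP].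
  exists (v |: T); first by rewrite cardsU1 vT ltnS.
  by move=> p /chiE/vT_ind.
have [T leT Tind] := step e (leqnn e); apply: leq_trans leT (Gd T _).
apply/independentP=> x y xT yT; apply/negP=> axy.
have := Tind ('X_x * 'X_y); rewrite subnn rmorphM /= !mrestrictX xT yT.
have -> : edge_pi k G ('X_x * 'X_y) = 0.
  by apply/edge_pi_eq0; rewrite -[X in X \in _]mul1r edge_mem.
have [[Q0 _ _] _] := Qprime 0%N (leq0n e).
by move=> /(_ Q0)/eqP; rewrite mulf_eq0 !(negPf (mpolyX_neq0 _ _)).

Qed.

(** The primes are the kernels of the maps to the domains [k[D t]], where [D t] omits the first [t]
    vertices of [S]; these maps kill the edge ideal because [D t] is independent. *)
Lemma prime_chain_independent (S : {set 'I_m}) :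
  independent G S -> prime_chain (edge_ring k G) #|S|.
Proof.
move=> iS; pose D t := [set x in drop t (enum S)].
have iD t : independent G (D t).
  apply: independentS iS; apply/subsetP=> x; rewrite inE => /mem_drop.
  by rewrite mem_enum.
pose Q t : {pred edge_ring k G} :=
  [pred z | `[< forall p, edge_pi k G p = z -> mrestrict k (D t) p = 0 >]].
have QE t p : (edge_pi k G p \in Q t) = (mrestrict k (D t) p == 0).
  apply/asboolP/eqP=> [/(_ _ erefl)//|p0 q /eqP].
  rewrite -subr_eq0 -rmorphB => /eqP/edge_pi_eq0/edge_ideal_mcoeff qp.
  rewrite -[q](subrK p) rmorphD p0 addr0; apply/mpolyP=> u.
  rewrite mrestrictE mcoeff0; case: ifP => // su; apply: qp.
  exact: independentS su (iD t).
exists Q; split=> t lt_t.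
  split; first split.
  - by rewrite -(rmorph0 (edge_pi k G)) QE rmorph0.
  - by rewrite -(rmorph1 (edge_pi k G)) QE rmorph1 oner_eq0.
  - move=> a u v; have [p <-] := edge_pi_surj a.
    have [q <-] := edge_pi_surj u; have [r <-] := edge_pi_surj v.
    rewrite -rmorphM -rmorphD !QE rmorphD rmorphM => /eqP-> /eqP->.
    by rewrite mulr0 addr0.
  move=> u v; have [q <-] := edge_pi_surj u; have [r <-] := edge_pi_surj v.
  by rewrite -rmorphM !QE rmorphM mulf_eq0.
have lt_te : (t < size (enum S))%N by rewrite -cardE.
split.
  move=> z; have [p <-] := edge_pi_surj z; rewrite !QE => /eqP p0.
  have -> : D t.+1 = D t.+1 :&: D t.
    apply/esym/setIidPl/subsetP=> x; rewrite !inE -addn1 addnC -drop_drop.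
    exact: mem_drop.
  by rewrite -mrestrict_comp p0 rmorph0.
(* The inclusion is strict at the variable of the vertex dropped in this step; [x0] only serves as
   the default of [nth]. *)
case: (enum S) (enum_uniq S) lt_te @D {iD} Q QE => // x0 l' Su lt_te D Q QE.
pose x := nth x0 (x0 :: l') t.
exists (edge_pi k G 'X_x); rewrite QE mrestrictX inE.
  rewrite ifF ?eqxx //; apply/negP.
  have := Su; rewrite -{1}(cat_take_drop t (x0 :: l')) (drop_nth x0 lt_te).
  by rewrite cat_uniq => /and3P[_ _ /= /andP[/negP]].
by rewrite (drop_nth x0 lt_te) inE eqxx /= mpolyX_neq0.
Qed.

End KrullDim.

(** * Criteria for the Cohen-Macaulay property *)

Section Criteria.
Variables (k : fieldType) (m : nat) (G : sgraph m).
Local Notation P := {mpoly k[m]}.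
Implicit Types (A C F S : {set 'I_m}) (u v : 'X_{1..m}).

(** The dimension is at least [#|S|] while the depth is at most [d]. *)
Lemma not_cohen_macaulay S d : independent G S -> (d < #|S|)%N ->
  (forall s : seq P, (forall f, f \in s -> max_ideal f) ->
     regular_sequence (edge_module k G) s -> (size s <= d)%N) ->
  ~ cohen_macaulay k G.
Proof.
move=> iS lt_dS depth_d [e [[_ /(_ _ (prime_chain_independent k iS)) le_Se]]].
move=> [[s [se sJ s_reg]] _]; have := depth_d s sJ s_reg.
by rewrite se leqNgt (leq_trans lt_dS).
Qed.

(** The largest independent set [F] fixes the dimension and, being a facet, also bounds the depth;
    [s] attains this bound. *)
Lemma cohen_macaulay_of_facet F (s : seq P) :
  independent G F -> (forall A, independent G A -> (#|A| <= #|F|)%N) ->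
  size s = #|F| -> (forall f, f \in s -> max_ideal f) ->
  regular_sequence (edge_module k G) s -> cohen_macaulay k G.
Proof.
move=> iF Fmax s_sz sJ s_reg; exists #|F|; split; split.
- exact: prime_chain_independent.
- by move=> e; apply: prime_chain_le.
- by exists s.
move=> e [q [<- qJ q_reg]]; apply: (depth_le_facet iF) qJ q_reg => x xF.
have [[y yF axy]|no_y] := EM (exists2 y, y \in F & adj G x y); first by exists y.
have /Fmax : independent G (x |: F).
  by apply: independentU1 => // y yF; apply/negP=> axy; apply: no_y; exists y.
by rewrite cardsU1 xF ltnn.
Qed.

Lemma seq_submod_edge (s : seq P) i (p : P) :
  seq_submod s i (edge_pi k G p : edge_module k G) <->
  exists q : nat -> P, p - \sum_(j < i) s`_j * q j \in @edge_ideal k m G.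
Proof.
split=> [[y]|[q]].
  have /choice[q qE] : forall j, exists q, edge_pi k G q = y j.
    by move=> j; apply: edge_pi_surj.
  under eq_bigr => j _ do rewrite -qE edge_module_scale.
  rewrite -raddf_sum => /eqP; rewrite -subr_eq0 -raddfB => /eqP/edge_pi_eq0.
  by exists q.
move=> /edge_pi_eq0/eqP; rewrite raddfB subr_eq0 => /eqP ->.
exists (fun j => edge_pi k G (q j)); rewrite raddf_sum.
by apply: eq_bigr => j _; rewrite edge_module_scale.
Qed.

(** The class of 1 works: neither the members of [s] nor the edge ideal contribute a constant
    term. *)
Lemma max_ideal_proper (s : seq P) : (forall f, f \in s -> max_ideal f) ->
  exists x : edge_module k G, ~ seq_submod s (size s) x.
Proof.
move=> sJ; exists (edge_pi k G 1) => /seq_submod_edge[q /edge_ideal_mcoeff].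
move=> /(_ 0%MM); rewrite mcoeffB mcoeff1 eqxx raddf_sum big1 /= => [|j _].
  rewrite subr0 => /(_ _)/eqP; rewrite oner_eq0 => /(_ _)/negP/=; apply=> //.
  apply: independentS (independent_set0 G).
  by apply/subsetP=> x; rewrite inE mnm0E.
have /max_idealP[a ->] := sJ _ (mem_nth 0 (ltn_ord j)).
rewrite mulr_suml raddf_sum big1 //= => x _.
rewrite mulrAC mcoeffMXE ifF //; apply/negP=> /mnm_lepP/(_ x).
by rewrite mnm1E eqxx mnm0E.
Qed.

Definition clique C : Prop := {in C &, forall x y, x != y -> adj G x y}.

Lemma clique_independent C A x y : clique C -> independent G A ->
  x \in C -> y \in C -> x \in A -> y \in A -> x = y.
Proof.
move=> cC /independentP iA xC yC xA yA; apply/eqP; apply: contraTT (iA x y xA yA).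
by rewrite negbK; apply: cC.
Qed.

Definition vertex_sum C : P := \sum_(x in C) 'X_x.

Lemma vertex_sum_max_ideal C : max_ideal (vertex_sum C).
Proof.
apply/max_idealP; exists (fun x => (x \in C)%:R).
rewrite /vertex_sum big_mkcond; apply: eq_bigr => x _.
by case: ifP; rewrite ?mul1r ?mul0r.
Qed.

Lemma mnm_supportDU u x : mnm_support (u + U_(x)) = x |: mnm_support u.
Proof.
apply/setP=> y; rewrite !inE mnmDE mnm1E (eq_sym y).
by case: (x == y); rewrite ?addn0 ?addn1.
Qed.

(** A face meets a clique in at most one vertex, so only the summand [X_x] contributes. *)
Lemma vertex_sum_mcoeff C x u (p : P) : clique C -> x \in C ->
  independent G (x |: mnm_support u) -> (vertex_sum C * p)@_(u + U_(x)) = p@_u.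
Proof.
move=> cC xC iA; rewrite mulr_suml raddf_sum (bigD1 x) //= [X in _ + X]big1.
  by rewrite addr0 mulrC addmC mcoeffMX.
move=> y /andP[yC yx]; rewrite mulrC mcoeffMXE; case: ifP => // le_y.
case/negP: yx; apply/eqP/(clique_independent cC iA) => //; last by rewrite !inE eqxx.
rewrite -mnm_supportDU; apply: (subsetP (mnm_support_subS le_y)).
by rewrite inE mnm1E eqxx.
Qed.

Lemma vertex_sum_mcoeff0 C u (p : P) : [disjoint C & mnm_support u] ->
  (vertex_sum C * p)@_u = 0.
Proof.
move=> /pred0P dC; rewrite mulr_suml raddf_sum big1 //= => y yC.
rewrite mulrC mcoeffMXE; case: ifP => // /mnm_support_subS/subsetP/(_ y).
by have := dC y; rewrite /= yC /= !inE mnm1E eqxx => -> /(_ isT).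
Qed.

(** Each coefficient of [p] on a face reappears in the product, on the face enlarged by a vertex of
    [C]. *)
Lemma vertex_sum_regular C (p : P) : clique C ->
  (forall A, independent G A -> exists2 x, x \in C & independent G (x |: A)) ->
  vertex_sum C * p \in @edge_ideal k m G -> p \in @edge_ideal k m G.
Proof.
move=> cC Cmeet /edge_ideal_mcoeff Ip; apply/edge_ideal_mcoeff => u iu.
have [x xC ixu] := Cmeet _ iu.
by rewrite -(vertex_sum_mcoeff p cC xC ixu) Ip // mnm_supportDU.
Qed.

Lemma complete_cohen_macaulay (x0 : 'I_m) :
  (forall x y, x != y -> adj G x y) -> cohen_macaulay k G.
Proof.
move=> Kn; have cT : clique setT by move=> x y _ _; apply: Kn.
have le1 A : independent G A -> (#|A| <= 1)%N.
  move=> iA; apply/card_le1_eqP => x y xA yA.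
  exact: (clique_independent cT iA).
have sJ f : f \in [:: vertex_sum setT] -> max_ideal f.
  by rewrite inE => /eqP->; apply: vertex_sum_max_ideal.
apply: (@cohen_macaulay_of_facet [set x0] [:: vertex_sum setT]) => //.
- exact: independent_set1.
- by rewrite cards1.
- by rewrite cards1.
split; last exact: max_ideal_proper.
case=> // _ x; have [p <-] := edge_pi_surj x.
rewrite edge_module_scale => /seq_submod_edge[q].
rewrite big_ord0 subr0 => Ip; apply/seq_submod_edge; exists q.
rewrite big_ord0 subr0; apply: vertex_sum_regular Ip => // A iA.
have [->|[x1 x1A]] := set_0Vmem A.
  by exists x0; rewrite ?inE // setU0 independent_set1.
by exists x1; rewrite ?inE // (setUidPr _) // sub1set.
Qed.

(** * Graphs covered by two cliques *)

Section TwoCliques.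
Variables (C D : {set 'I_m}) (a0 : 'I_m).
Hypotheses (cC : clique C) (cD : clique D) (a0C : a0 \in C).
Hypotheses (CD_cover : forall x, (x \in C) || (x \in D)).
Hypothesis CD_disjoint : [disjoint C & D].
(** In the independence complex any two vertices of [C] are joined through one of [D]; the case of
    equal vertices gives each one a non-neighbour in [D]. *)
Hypothesis C_common : {in C &, forall a a', exists2 b, b \in D &
  ~~ adj G a b && ~~ adj G a' b}.
Hypothesis D_nonadj : {in D, forall b, exists2 a, a \in C & ~~ adj G a b}.

Lemma independent_pair a b : ~~ adj G a b -> independent G (a |: [set b]).
Proof.
by move=> ab; apply: independentU1 => [|y /set1P->//]; apply: independent_set1.
Qed.

Lemma independent_in_D A b : independent G A -> [disjoint C & A] -> b \in A ->
  b \in D /\ A = [set b].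
Proof.
move=> iA /pred0P dCA bA; have AD x : x \in A -> x \in D.
  by move=> xA; have := dCA x; have := CD_cover x; rewrite /= xA andbT => /orP[->|].
split; first exact: AD.
apply/setP=> x; rewrite inE; apply/idP/eqP=> [xA|->] //.
by apply: (clique_independent cD iA); rewrite ?AD.
Qed.

Lemma meets_C A : independent G A -> exists2 x, x \in C & independent G (x |: A).
Proof.
move=> iA; have [/[dup] dCA|] := boolP [disjoint C & A].
  have [->|[b bA]] := set_0Vmem A; last move=> /(independent_in_D iA)/(_ bA)[bD ->].
    by exists a0; rewrite // setU0 independent_set1.
  by have [a aC ab] := D_nonadj bD; exists a => //; apply: independent_pair.
case/pred0Pn=> x /= /andP[xC xA]; exists x => //.
by rewrite (setUidPr _) // sub1set.
Qed.

Lemma two_cliques_quotient (p q : P) :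
  vertex_sum D * p - vertex_sum C * q \in @edge_ideal k m G ->
  exists r, p - vertex_sum C * r \in @edge_ideal k m G.
Proof.
move=> /edge_ideal_mcoeff pq.
(* On a face containing a and b, the polynomial p is divisible by X_a, q is
   divisible by X_b, and both quotients agree; r is glued from them. *)
have R1 u a b : a \in C -> b \in D -> independent G (a |: (b |: mnm_support u)) ->
    p@_(u + U_(a)) = q@_(u + U_(b)).
  move=> aC bD iab; have := pq (u + U_(a) + U_(b))%MM.
  rewrite !mnm_supportDU mcoeffB setUCA => /(_ iab)/eqP.
  rewrite vertex_sum_mcoeff ?mnm_supportDU // 1?setUCA //.
  rewrite -addmA (addmC U_(a)%MM) addmA vertex_sum_mcoeff ?mnm_supportDU //.
  by rewrite subr_eq0 => /eqP.
(* The coefficient does not depend on the vertex of [C]: if [u] avoids [C], two choices are compared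
   through a common non-neighbour in [D]; otherwise only one choice exists. *)
have R2 u a a' : a \in C -> a' \in C -> independent G (a |: mnm_support u) ->
    independent G (a' |: mnm_support u) -> p@_(u + U_(a)) = p@_(u + U_(a')).
  move=> aC a'C iau ia'u; have [dCu|] := boolP [disjoint C & mnm_support u].
    have [b bD [iab ia'b]] : exists2 b, b \in D &
        independent G (a |: (b |: mnm_support u)) /\
        independent G (a' |: (b |: mnm_support u)).
      have iu := independentS (subsetUr _ _) iau.
      have [uE|[b bu]] := set_0Vmem (mnm_support u).
        have [b bD /andP[ab a'b]] := C_common aC a'C.
        by exists b; rewrite // uE setU0; split; apply: independent_pair.
      have [bD _] := independent_in_D iu dCu bu; exists b => //.
      by rewrite (setUidPr (_ : [set b] \subset _)) ?sub1set.
    by rewrite (R1 u a b) // (R1 u a' b).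
  case/pred0Pn=> x /= /andP[xC xu].
  have xE z : z \in C -> independent G (z |: mnm_support u) -> z = x.
    move=> zC iz; apply: (clique_independent cC iz) => //.
      by rewrite in_setU1 eqxx.
    by rewrite in_setU1 xu orbT.
  by rewrite (xE a aC iau) (xE a' a'C ia'u).
pose E u := if [pick a in C | independent G (a |: mnm_support u)] is Some a
  then p@_(u + U_(a)) else 0.
have EE u a : a \in C -> independent G (a |: mnm_support u) -> E u = p@_(u + U_(a)).
  move=> aC iau; rewrite /E; case: pickP => [a' /andP[a'C ia'u]|/(_ a)].
    exact: R2.
  by rewrite aC iau.
(* The degree bound loses nothing: in degrees from [msize p] on, [E] reads vanishing coefficients of
   [p]. *)
pose r : P := \sum_(u : 'X_{1..m < msize p}) E u *: 'X_[u].
have rE u : r@_u = E u.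
  have [lt_u|le_u] := ltnP (mdeg u) (msize p); first exact: mcoeff_mpoly.
  rewrite raddf_sum big1 /= => [|w _].
    rewrite /E; case: pickP => // a _; apply/esym/memN_msupp_eq0/msize_mdeg_ge.
    by rewrite mdegD (leq_trans le_u) ?leq_addr.
  rewrite mcoeffZ mcoeffX; case: eqP => [wu|]; last by rewrite mulr0.
  by have := bmdeg w; rewrite wu ltnNge le_u.
exists r; apply/edge_ideal_mcoeff=> v iv; rewrite mcoeffB; apply/eqP; rewrite subr_eq0.
have [dCv|] := boolP [disjoint C & mnm_support v].
  rewrite [X in _ == X]vertex_sum_mcoeff0 //.
  (* Off [C] the coefficient of [p] must vanish: it is seen at the face enlarged by [b], where
     [vertex_sum C * q] contributes nothing. *)
  have [b bD ibv] : exists2 b, b \in D & independent G (b |: mnm_support v).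
    have [->|[b bv]] := set_0Vmem (mnm_support v).
      have [b bD _] := C_common a0C a0C.
      by exists b; rewrite // setU0 independent_set1.
    have [bD _] := independent_in_D iv dCv bv; exists b => //.
    by rewrite (setUidPr _) ?sub1set.
  have := pq (v + U_(b))%MM; rewrite mnm_supportDU => /(_ ibv).
  rewrite mcoeffB vertex_sum_mcoeff // vertex_sum_mcoeff0 ?subr0 => [->//|].
  apply/pred0P => x /=; rewrite mnm_supportDU !inE; apply/negP.
  case/andP=> xC /orP[/eqP xb|xv].
    by have /pred0P/(_ b) := CD_disjoint; rewrite /= bD -xb xC.
  by have /pred0P/(_ x) := dCv; rewrite /= xC inE xv.
case/pred0Pn=> a /= /andP[aC av].
have le_a : (U_(a) <= v)%MM.
  apply/mnm_lepP=> i; rewrite mnm1E; case: eqP => [<-|] //.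
  by move: av; rewrite inE lt0n.
have iav : independent G (a |: mnm_support (v - U_(a))).
  by rewrite -mnm_supportDU submK.
by rewrite -[v in X in _ == X](submK le_a) vertex_sum_mcoeff // rE (EE _ a) // submK.
Qed.

Lemma two_cliques_cohen_macaulay : cohen_macaulay k G.
Proof.
have [b0 b0D /andP[ab0 _]] := C_common a0C a0C.
pose s := [:: vertex_sum C; vertex_sum D].
have a0b0 : a0 != b0.
  apply: contraTneq CD_disjoint => e; apply/pred0Pn.
  by exists a0; rewrite /= a0C e.
have card_F : #|[set a0; b0]| = 2 by rewrite cards2 a0b0.
have sJ f : f \in s -> max_ideal f.
  by rewrite !inE => /orP[]/eqP->; apply: vertex_sum_max_ideal.
apply: (@cohen_macaulay_of_facet [set a0; b0] s) => //.
- exact: independent_pair.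
(* An independent set has at most one vertex in each clique. *)
- move=> A iA; rewrite card_F -(cardsID C) -[2]/(1 + 1)%N.
  apply: leq_add; apply/card_le1_eqP => x y; rewrite !inE.
    by move=> /andP[xA xC] /andP[yA yC]; apply: (clique_independent cC iA).
  have inD z : z \notin C -> z \in D by have := CD_cover z; case: (z \in C).
  by move=> /andP[/inD xD xA] /andP[/inD yD yA]; apply: (clique_independent cD iA).
split; last exact: max_ideal_proper.
case=> [|[|//]] _ x; have [p <-] := edge_pi_surj x; rewrite edge_module_scale.
  move=> /seq_submod_edge[q]; rewrite big_ord0 subr0 => Ip.
  apply/seq_submod_edge; exists q.
  by rewrite big_ord0 subr0; apply: vertex_sum_regular Ip => //; apply: meets_C.
move=> /seq_submod_edge[q]; rewrite big_ord1 => /two_cliques_quotient[r Ir].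
by apply/seq_submod_edge; exists (fun=> r); rewrite big_ord1.
Qed.

End TwoCliques.
End Criteria.

(** * Facets of different sizes *)

Section Obstructions.
Variables (k : fieldType) (m : nat) (G : sgraph m).
Implicit Types (A F : {set 'I_m}) (x y z : 'I_m).

(* Extend F1 to a set F0 which is maximal among the independent sets avoiding
   the closed neighbourhood of v.  Then v |: F0 is a facet, while replacing v by
   two nonadjacent neighbours of v gives a larger independent set. *)
Lemma not_cohen_macaulay_star (v u w : 'I_m) (F1 : {set 'I_m}) :
  independent G F1 ->
  (forall x y, x \in F1 -> (y == v) || adj G v y -> (y != x) && ~~ adj G y x) ->
  (forall y z, adj G v y -> adj G y z -> z != v -> ~~ adj G v z ->
     exists2 x, x \in F1 & (z == x) || adj G z x) ->
  adj G v u -> adj G v w -> u != w -> ~~ adj G u w ->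
  ~ cohen_macaulay k G.
Proof.
move=> iF1 F1far F1dom vu vw uw nuw.
pose N := [set y | (y == v) || adj G v y].
pose Q A := independent G A && [disjoint A & N].
have QF1 : Q F1.
  rewrite /Q iF1; apply/pred0P=> x /=; apply/negP=> /andP[xF1]; rewrite inE.
  by move/(F1far x x xF1); rewrite eqxx.
have [F0 /maxsetP[/andP[iF0 /pred0P dF0] F0max] sF10] := maxset_exists QF1.
have iF0' := independentP G F0 iF0.
have F0N x : x \in F0 -> (x == v) || adj G v x = false.
  by move=> xF0; have := dF0 x; rewrite /= xF0 inE.
(* A vertex of [F0] adjacent to a neighbour of [v] would be at distance two from [v], hence in [F1]
   or adjacent to it, against [F1far] or the independence of [F0]. *)
have far x y : x \in F0 -> (y == v) || adj G v y -> ~~ adj G y x.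
  move=> xF0 /orP[/eqP->|vy]; first by have /norP[] := negbT (F0N x xF0).
  apply/negP=> yx; have /norP[xv nvx] := negbT (F0N x xF0).
  have [x1 x1F1 /orP[/eqP xx1|xx1]] := F1dom y x vy yx xv nvx.
    by have /andP[_] := F1far x1 y x1F1 (introT orP (or_intror vy)); rewrite -xx1 yx.
  by have := iF0' x x1 xF0 (subsetP sF10 _ x1F1); rewrite xx1.
have dom z : z \notin F0 -> ~~ ((z == v) || adj G v z) -> exists2 x, x \in F0 & adj G z x.
  move=> zF0 zN; apply/exists_inP; apply: contraNT zF0.
  rewrite negb_exists_in => /forall_inP nz.
  rewrite -(F0max (z |: F0)) ?setU11 ?subsetUr // /Q independentU1 //=.
  apply/pred0P=> x /=; rewrite !inE; apply/negP=> /andP[/orP[/eqP->|/F0N->]] //.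
  by rewrite (negPf zN).
have vF0 : v \notin F0 by apply/negP=> /F0N; rewrite eqxx.
have wF0 : w \notin F0 by apply/negP=> /F0N; rewrite vw orbT.
have uF0 : u \notin w |: F0.
  by rewrite !inE negb_or uw; apply/negP=> /F0N; rewrite vu orbT.
apply: (@not_cohen_macaulay k m G (u |: (w |: F0)) #|v |: F0|).
- apply: independentU1 => [|y /setU1P[->|yF0]] //; last by rewrite far // vu orbT.
  by apply: independentU1 => // y yF0; rewrite far // vw orbT.
- by rewrite !cardsU1 uF0 wF0 vF0 !add1n.
move=> s; apply: depth_le_facet.
  by apply: independentU1 => // y yF0; rewrite far // eqxx.
move=> x; rewrite !inE negb_or => /andP[xv xF0].
have [vx|nvx] := boolP (adj G v x); first by exists v; rewrite ?inE ?eqxx // adj_sym.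
have [|y yF0 xy] := dom x xF0; first by rewrite negb_or xv.
by exists y; rewrite // !inE yF0 orbT.
Qed.

End Obstructions.

(** * Cubic circulants as labelled graphs *)

(* For i, j < 2h this says i - j = a, -a or h modulo 2h, in linear form. *)
Definition circ_adj (a h i j : nat) : bool :=
  [|| i == j + a, j == i + a, i + (h + h) == j + a, j + (h + h) == i + a,
      i == j + h | j == i + h]%N.

Lemma circ_adjP a h i j :
  reflect (i = j + a \/ j = i + a \/ i + (h + h) = j + a \/
           j + (h + h) = i + a \/ i = j + h \/ j = i + h)%N (circ_adj a h i j).
Proof.
rewrite /circ_adj; apply: (iffP idP) => [/or4P[|||/or3P[]] /eqP|]; try tauto.
by move=> [|[|[|[|[]]]]] /eqP->; rewrite ?orbT.
Qed.

(** An isomorphism to the circulant graph with natural numbers as values, so that adjacency is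
    settled by linear arithmetic or computation. *)
Definition circ_label m (G : sgraph m) (a h : nat) (f : 'I_m -> nat) : Prop :=
  [/\ injective f, forall x, (f x < h + h)%N,
      forall i, (i < h + h)%N -> exists x, f x = i
    & forall x y, adj G x y = circ_adj a h (f x) (f y)].

Lemma circulant_adjE n a h (S : seq nat) (i j : 'I_n) :
  n = (h + h)%N -> (0 < a < h)%N -> S =i [:: a; h] ->
  circulant_rel S i j = circ_adj a h i j.
Proof.
move=> nE /andP[a0 ah] SE; rewrite /circulant_rel SE !inE /circ_adj -val_eqE /=.
have := ltn_ord i; have := ltn_ord j.
case: (leqP i j) => [ij|/ltnW ji]; [rewrite distnEr //|rewrite distnEl //]; lia.
Qed.

Lemma sg_iso_label m (G : sgraph m) a h : (0 < a < h)%N ->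
  sg_iso G (circulant (h + h) [:: a; h]) -> exists f, circ_label G a h f.
Proof.
move=> ah [f [g fK gK] fE]; exists (fun x => f x : nat); split=> [x y|x|i lt_i|x y].
- by move/ord_inj/(can_inj fK).
- exact: ltn_ord.
- by exists (g (Ordinal lt_i)); rewrite gK.
by rewrite -fE /= (circulant_adjE _ _ erefl ah).
Qed.

(** Negation exchanges the neighbours of 0 below and above half the order, and at most one lies
    exactly at half. Degree 3 therefore forces one of each kind. *)
Lemma cubic_circulant m (G : sgraph m) : sg_connected G -> is_circulant G -> cubic G ->
  exists a h, [/\ (0 < a < h)%N & sg_iso G (circulant (h + h) [:: a; h])].
Proof.
move=> [m0 _] [[|n] [S [n_gt0 S_bound [f [g fK gK] fE]]]] cG; first by [].
pose N := [set j : 'I_n.+1 | circulant_rel S 0 j].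
have cN : #|N| = 3%N.
  rewrite -(cG (g 0)) -[RHS](card_imset _ (can_inj fK)).
  apply: eq_card => j.
  apply/idP/imsetP=> [jN|[y]]; last by rewrite inE -fE gK => yN ->; rewrite inE.
  by exists (g j); rewrite ?gK // inE -fE !gK; rewrite inE in jN.
have NE (j : 'I_n.+1) : (j \in N) = (0 < j)%N && (minn j (n.+1 - j) \in S).
  by rewrite inE /circulant_rel eq_sym -val_eqE /= dist0n lt0n.
pose N1 := [set j in N | (j + j < n.+1)%N].
pose N2 := [set j in N | (n.+1 < j + j)%N].
pose N3 := [set j in N | (j + j == n.+1)%N].
have cN12 : #|N2| = #|N1|.
  rewrite -[RHS](card_imset _ (@oppr_inj 'I_n.+1)); apply: eq_card => j.
  have oppE (i : 'I_n.+1) : (0 < i)%N -> (- i : 'I_n.+1) = (n.+1 - i)%N :> nat.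
    by move=> i0; rewrite /= modn_small //; have := ltn_ord i; lia.
  have mem12 (i : 'I_n.+1) : (i \in N1) = (- i \in N2).
    rewrite [LHS]inE [RHS]inE !NE; have [->|i0] := eqVneq i 0; first by rewrite oppr0.
    have {}i0 : (0 < i)%N by rewrite lt0n; apply: contraNneq i0 => i0; apply/eqP/val_inj.
    rewrite oppE // i0; have := ltn_ord i => lt_i.
    rewrite subn_gt0 lt_i (subKn (ltnW lt_i)) [in RHS]minnC; congr (_ && _); lia.
  apply/idP/imsetP=> [jN2|[i iN1 ->]]; last by rewrite -mem12.
  by exists (- j); rewrite ?opprK // mem12 opprK.
have cN3 : (#|N3| <= 1)%N.
  apply/card_le1_eqP=> i j; rewrite !inE => /andP[_ /eqP ii] /andP[_ /eqP jj].
  by apply/val_inj; move: ii jj => /=; lia.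
have : #|N| = (#|N1| + #|N2| + #|N3|)%N.
  rewrite -(cardsID [set j : 'I_n.+1 | (j + j < n.+1)%N] N) -addnA; congr (_ + _)%N.
    by apply: eq_card => j; rewrite !inE.
  rewrite -(cardsID [set j : 'I_n.+1 | (n.+1 < j + j)%N] (N :\: _)); congr (_ + _)%N.
    by apply: eq_card => j; rewrite !in_set -/N; case: (j \in N); rewrite ?andbF //=; lia.
  by apply: eq_card => j; rewrite !in_set -/N; case: (j \in N); rewrite ?andbF //=; lia.
rewrite cN12 cN => cNE.
have /eqP/cards1P[a N1E] : #|N1| = 1%N by lia.
have /eqP/cards1P[h N3E] : #|N3| = 1%N by lia.
have : a \in N1 by rewrite N1E inE.
have : h \in N3 by rewrite N3E inE.
rewrite [_ \in N3]inE NE => /andP[/andP[h0 hS] /eqP hh].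
rewrite [_ \in N1]inE NE => /andP[/andP[a0 aS] aa].
have ah : (0 < a < h)%N by lia.
(* An [s] in [S] below [h] is itself a neighbour of 0 in [N1], hence equals [a]. *)
have SE : S =i [:: (a : nat); (h : nat)].
  move=> s; rewrite !inE; apply/idP/orP=> [sS|[]/eqP->]; last 2 first.
  - by rewrite (_ : nat_of_ord a = minn a (n.+1 - a)) //; lia.
  - by rewrite (_ : nat_of_ord h = minn h (n.+1 - h)) //; lia.
  have := S_bound s sS; rewrite -[X in X./2]hh addnn doubleK => /andP[s0].
  rewrite leq_eqVlt => /orP[->|sh]; [by right|left].
  have lt_sn : (s < n.+1)%N by lia.
  have : Ordinal lt_sn \in N1.
    rewrite [_ \in N1]inE NE s0 /=; apply/andP; split; last by lia.
    by rewrite (_ : minn s _ = s) //; lia.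
  by rewrite N1E inE -val_eqE.
exists a, h; split=> //; rewrite hh; exists f; first by exists g.
by move=> x y; rewrite -fE /= !(circulant_adjE _ _ (esym hh) ah).
Qed.

Lemma all_iotaP n (p : pred nat) :
  reflect (forall i, (i < n)%N -> p i) (all p (iota 0 n)).
Proof.
by apply: (iffP allP) => H i; have := H i; rewrite mem_iota.
Qed.

(** * The individual cubic circulants *)

Section CubicCirculants.
Variables (k : fieldType) (m : nat) (G : sgraph m).
Implicit Types f : 'I_m -> nat.

(* The vertices at distance two from 0 are 2a, -2a, h + a and h - a; they are
   dominated by h + 2a and h - 2a. *)
Lemma label_not_cohen_macaulay a h f : (0 < a < h)%N -> circ_label G a h f ->
  a + a != h -> 3 * a != h -> 4 * a != h -> 4 * a != 3 * h -> 3 * a != 2 * h ->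
  5 * a != 2 * h -> 5 * a != 4 * h -> ~ cohen_macaulay k G.
Proof.
move=> ah [f_inj f_lt f_surj fE] n2 n3 n4 n43 n32 n52 n54.
have [v fv] : exists x, f x = 0%N by apply: f_surj; lia.
have [u fu] : exists x, f x = a by apply: f_surj; lia.
have [w fw] : exists x, f x = (h + h - a)%N by apply: f_surj; lia.
(* The labels are [h + 2a] and, below, [h - 2a], both reduced modulo [2h]. *)
have [x1 fx1] : exists x, f x = (if a + a < h then h + (a + a) else a + a - h)%N.
  by apply: f_surj; case: ifP; lia.
have [x2 fx2] : exists x,
    f x = (if a + a < h then h - (a + a) else h + h + h - (a + a))%N.
  by apply: f_surj; case: ifP; lia.
have eqE x y : (x == y) = (f x == f y) by rewrite (inj_eq f_inj).
apply: (@not_cohen_macaulay_star k m G v u w [set x1; x2]).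
- apply: independent_pair; rewrite fE fx1 fx2; clear n2 n3.
  by apply/circ_adjP; case: ifP; lia.
- clear n52 n54; move=> x y xF vy; rewrite eqE fE.
  have {vy} fy : (f y = 0 \/ f y = a \/ f y = h + h - a \/ f y = h)%N.
    clear n2 n3 n4 n43 n32; move: vy (f_lt y).
    by rewrite eqE fE fv => /orP[/eqP|/circ_adjP]; lia.
  case/set2P: xF => ->; rewrite ?fx1 ?fx2.
    by case: fy => [|[|[]]] ->; (apply/andP; split; [|apply/circ_adjP]); case: ifP; lia.
  by case: fy => [|[|[]]] ->; (apply/andP; split; [|apply/circ_adjP]); case: ifP; lia.
- clear n2 n3 n4 n43 n32 n52 n54; move=> y z; rewrite !eqE !fE fv.
  move=> /circ_adjP vy /circ_adjP yz /eqP zv /circ_adjP nvz.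
  have lt_y := f_lt y; have lt_z := f_lt z.
  have fy : (f y = a \/ f y = h + h - a \/ f y = h)%N.
    by clear yz zv nvz lt_z; lia.
  have fz : (f z = a + a \/ f z = h + a \/ f z = h + h - (a + a) \/ f z = h - a)%N.
    by clear vy; case: fy => [|[]] fy; rewrite fy in yz lt_y; clear fy lt_y nvz; lia.
  clear vy yz zv nvz fy lt_y lt_z.
  case: fz => [fz|[fz|fz]].
  - exists x1; rewrite ?inE ?eqxx // fE; apply/orP/or_intror/circ_adjP.
    by rewrite fx1 fz; case: ifP; lia.
  - exists x1; rewrite ?inE ?eqxx // fE; apply/orP/or_intror/circ_adjP.
    by rewrite fx1 fz; case: ifP; lia.
  - exists x2; rewrite ?inE ?eqxx ?orbT // fE; apply/orP/or_intror/circ_adjP; rewrite fx2.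
    by case: fz => ->; case: ifP; lia.
- by clear n3 n4 n43 n32 n52 n54; rewrite fE fv fu; apply/circ_adjP; lia.
- by clear n3 n4 n43 n32 n52 n54; rewrite fE fv fw; apply/circ_adjP; lia.
- by clear n3 n4 n43 n32 n52 n54; rewrite eqE fu fw; lia.
- by clear n4 n43 n52 n54; rewrite fE fu fw; apply/circ_adjP; lia.
Qed.

(** This graph is [K_{3,3}]: nonadjacent vertices have labels of equal parity, so parity separates
    the components of the independence complex. *)
Lemma label_1_3_not_cohen_macaulay f : circ_label G 1 3 f -> ~ cohen_macaulay k G.
Proof.
move=> [f_inj f_lt f_surj fE].
have [x0 f0] := f_surj 0%N isT; have [x1 f1] := f_surj 1%N isT.
have [x2 f2] := f_surj 2%N isT.
have i02 : independent G [set x0; x2] by apply: independent_pair; rewrite fE f0 f2.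
have x02 : x0 != x2 by rewrite -(inj_eq f_inj) f0 f2.
apply: (@not_cohen_macaulay k m G _ 1 i02) => [|s]; first by rewrite cards2 x02.
apply: (@depth_le1 k m G (fun x => odd (f x)) x1 x0); rewrite ?f0 ?f1 // => x y.
rewrite -(inj_eq f_inj) fE.
have H : all (fun i => all (fun j => (i != j) ==> ~~ circ_adj 1 3 i j ==>
  (odd i == odd j)) (iota 0 6)) (iota 0 6) by vm_compute.
move=> xy nxy; move/all_iotaP: H => /(_ _ (f_lt x))/all_iotaP/(_ _ (f_lt y)).
by rewrite xy nxy => /eqP.
Qed.

Definition winding (h i j : nat) : k := (i + h < j)%N%:R - (j + h < i)%N%:R.

(* Here the independence complex is homotopy equivalent to a circle, and winding
   is a cocycle generating its first cohomology group. *)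
Lemma winding_not_cohen_macaulay h f : h = 4 \/ h = 5 ->
  circ_label G h.-1 h f -> ~ cohen_macaulay k G.
Proof.
move=> h45 [f_inj f_lt f_surj fE].
have eqE x y : (x == y) = (f x == f y) by rewrite (inj_eq f_inj).
have [x0 _] : exists x, f x = 0%N by apply: f_surj; lia.
have /choice[g gK] : forall i, exists x, (i < h + h)%N -> f x = i.
  by move=> i; have [/f_surj[x fx]|_] := ltnP i (h + h); [exists x|exists x0].
have [f0 f1 f2] : [/\ f (g 0%N) = 0%N, f (g 1%N) = 1%N & f (g 2%N) = 2%N].
  by split; apply: gK; lia.
have i012 : independent G (g 0%N |: (g 1%N |: [set g 2%N])).
  apply: independentU1 => [|y /setU1P[->|/set1P->]].
  - by apply: independent_pair; rewrite fE f1 f2; case: h45 => ->.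
  - by rewrite fE f0 f1; case: h45 => ->.
  - by rewrite fE f0 f2; case: h45 => ->.
apply: (@not_cohen_macaulay k m G _ 2 i012) => [|s].
  by rewrite !cardsU1 cards1 !inE !eqE f0 f1 f2.
apply: (@depth_le2 k m G (fun x y => winding h (f x) (f y))) => [x y|x y z|psi psiE].
- by rewrite /winding opprB.
- rewrite /= !inE negb_or !eqE !fE andbT => /andP[/andP[xy xz] yz] nxy nyz nxz.
  (* The cocycle condition is checked as an identity of natural numbers, hence holds in every
     field. *)
  suff E : ((f x + h < f y) + (f y + h < f z) + (f z + h < f x) =
            (f y + h < f x) + (f z + h < f y) + (f x + h < f z))%N.
    have := congr1 (fun n => n%:R : k) E; rewrite !natrD => /eqP.
    by rewrite -subr_eq0 => /eqP; apply: etrans; rewrite /winding; ring.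
  pose b h i j l := [&& (i != j), (i != l), (j != l), ~~ circ_adj h.-1 h i j,
      ~~ circ_adj h.-1 h j l & ~~ circ_adj h.-1 h i l] ==>
    ((i + h < j) + (j + h < l) + (l + h < i) ==
     (j + h < i) + (l + h < j) + (i + h < l))%N.
  have H : all (fun i => all (fun j => all (b h i j) (iota 0 (h + h)))
     (iota 0 (h + h))) (iota 0 (h + h)) by case: h45 => ->; vm_compute.
  move/all_iotaP: H => /(_ _ (f_lt x))/all_iotaP/(_ _ (f_lt y))/all_iotaP/(_ _ (f_lt z)).
  by rewrite /b xy xz yz nxy nyz nxz => /eqP.
have E i j : (i < h + h)%N -> (j < h + h)%N -> i != j -> ~~ circ_adj h.-1 h i j ->
    psi (g j) = psi (g i) + winding h i j.
  move=> lt_i lt_j ij nij; have := psiE (g i) (g j).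
  by rewrite eqE fE !gK // => -> //; rewrite addrC subrK.
(* Going once around through the even labels, only the last step back to 0 has nonzero winding,
   namely -1. *)
suff : psi (g 0%N) = psi (g 0%N) - 1.
  by move/eqP; rewrite -subr_eq0 opprB addrC subrK oner_eq0.
case: h45 => h_eq; rewrite h_eq in E.
  rewrite {1}(E 6 0)%N // (E 4 6)%N // (E 2 4)%N // (E 0 2)%N //.
  by rewrite /winding /= !subrr !addr0 sub0r.
rewrite {1}(E 8 0)%N // (E 6 8)%N // (E 4 6)%N // (E 2 4)%N // (E 0 2)%N //.
by rewrite /winding /= !subrr !addr0 sub0r.
Qed.

(** Relabelling by the unit [c] modulo [2h], with inverse [d]; the premises are boolean tests
    decided by computation for concrete numbers. *)
Lemma circ_label_mul a b h c d f :
  all (fun i => (c * i %% (h + h) < h + h) && (d * (c * i %% (h + h)) %% (h + h) == i))%N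
    (iota 0 (h + h)) ->
  all (fun i => (d * i %% (h + h) < h + h) && (c * (d * i %% (h + h)) %% (h + h) == i))%N
    (iota 0 (h + h)) ->
  all (fun i => all (fun j => circ_adj a h i j ==
      circ_adj b h (c * i %% (h + h)) (c * j %% (h + h))) (iota 0 (h + h)))%N
    (iota 0 (h + h)) ->
  circ_label G a h f -> exists f', circ_label G b h f'.
Proof.
move=> /all_iotaP cP /all_iotaP dP /all_iotaP abP [f_inj f_lt f_surj fE].
exists (fun x => c * f x %% (h + h))%N; split=> [x y e|x|i lt_i|x y].
- apply: f_inj; have /andP[_ /eqP <-] := cP _ (f_lt x).
  by rewrite e; have /andP[_ /eqP] := cP _ (f_lt y).
- by have /andP[] := cP _ (f_lt x).
- have /andP[/f_surj[x fx] /eqP di] := dP i lt_i.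
  by exists x; rewrite fx.
by rewrite fE; apply/eqP; have /all_iotaP := abP _ (f_lt x); apply.
Qed.

(** This graph is complete on four vertices. *)
Lemma label_1_2_cohen_macaulay f : circ_label G 1 2 f -> cohen_macaulay k G.
Proof.
move=> [f_inj f_lt f_surj fE]; have [x0 _] := f_surj 0%N isT.
apply: (complete_cohen_macaulay k x0) => x y; rewrite -(inj_eq f_inj) fE.
by apply/implyP; move: (f x) (f y) (f_lt x) (f_lt y) => [|[|[|[|//]]]] [|[|[|[|//]]]].
Qed.

(** This graph is the triangular prism. Its triangles are the parity classes, and each vertex has
    one neighbour in the other triangle, so two vertices of one triangle leave a common
    non-neighbour. *)
Lemma label_2_3_cohen_macaulay f : circ_label G 2 3 f -> cohen_macaulay k G.
Proof.
move=> [f_inj f_lt f_surj fE]; have [x0 f0] := f_surj 0%N isT.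
have eqE x y : (x == y) = (f x == f y) by rewrite (inj_eq f_inj).
have cl b : clique G [set x | odd (f x) == b].
  move=> x y; rewrite !inE => /eqP xb /eqP yb; rewrite eqE fE; apply/implyP.
  have H : all (fun i => all (fun j => (odd i == odd j) ==> (i != j) ==>
    circ_adj 2 3 i j) (iota 0 6)) (iota 0 6) by vm_compute.
  move/all_iotaP: H => /(_ _ (f_lt x))/all_iotaP/(_ _ (f_lt y)).
  by rewrite xb yb eqxx.
apply: (@two_cliques_cohen_macaulay k m G [set x | odd (f x) == false]
          [set x | odd (f x) == true] x0) => //.
- by rewrite inE f0.
- by move=> x; rewrite !inE; case: (odd (f x)).
- by apply/pred0P=> x /=; rewrite !inE; case: (odd (f x)).
- move=> x y; rewrite !inE => xb yb.
  have H : all (fun i => all (fun j => [&& ~~ odd i & ~~ odd j] ==>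
     has (fun l => [&& odd l, ~~ circ_adj 2 3 i l & ~~ circ_adj 2 3 j l])
       (iota 0 6)) (iota 0 6)) (iota 0 6) by vm_compute.
  move/all_iotaP: H => /(_ _ (f_lt x))/all_iotaP/(_ _ (f_lt y)).
  rewrite (eqP xb) (eqP yb) => /hasP[l]; rewrite mem_iota.
  move=> /f_surj[z <-] /and3P[zo xz yz].
  by exists z; rewrite ?inE ?fE ?zo // xz yz.
move=> x; rewrite !inE => xb.
have H : all (fun i => odd i ==> has (fun l => ~~ odd l && ~~ circ_adj 2 3 l i)
     (iota 0 6)) (iota 0 6) by vm_compute.
move/all_iotaP: H => /(_ _ (f_lt x)); rewrite (eqP xb) => /hasP[l].
rewrite mem_iota => /f_surj[z <-] /andP[zo xz].
by exists z; rewrite ?inE ?fE ?(negPf zo).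
Qed.

End CubicCirculants.

(** * Connectedness and the case distinction *)

(** Labels modulo [d] are constant along edges, so 0 and 1 agree modulo [d]. *)
Lemma connected_label_dvdn m (G : sgraph m) a h f d : sg_connected G ->
  (0 < a < h)%N -> circ_label G a h f -> (d %| a)%N -> (d %| h)%N -> d = 1%N.
Proof.
move=> [_ Gconn] ah [_ _ f_surj fE] da dh.
have modD p i : (d %| p)%N -> ((i + p) %% d = i %% d)%N.
  by move=> /eqP p0; rewrite -modnDmr p0 addn0.
have dhh : (d %| h + h)%N by rewrite dvdn_add.
have adj_mod x y : adj G x y -> (f x %% d = f y %% d)%N.
  rewrite fE => /circ_adjP[|[|[|[|[|]]]]] e.
  - by rewrite e modD.
  - by rewrite e modD.
  - by rewrite -(modD _ (f x) dhh) e modD.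
  - by rewrite -(modD _ (f y) dhh) e modD.
  - by rewrite e modD.
  - by rewrite e modD.
have conn_mod x y : (f x %% d = f y %% d)%N.
  have /connectP[p px ->] := Gconn x y.
  by elim: p x px => //= z p IHp x /andP[/adj_mod-> /IHp].
have [x fx] : exists x, f x = 0%N by apply: f_surj; lia.
have [y fy] : exists y, f y = 1%N by apply: f_surj; lia.
apply/eqP; rewrite -dvdn1; apply/eqP.
by rewrite -fy -(conn_mod x y) fx mod0n.
Qed.

Local Close Scope ring_scope.

Theorem theorem5p2 (k : fieldType) (m : nat) (G : sgraph m)
    (Gconn : sg_connected G) (Gcirc : is_circulant G) (Gcubic : cubic G) :
  cohen_macaulay k G <->
  (sg_iso G (circulant 4 [:: 1; 2]) \/ sg_iso G (circulant 6 [:: 2; 3])).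
Proof.
split=> [cmG|[G42|G63]]; last 2 first.
- by have [f /label_1_2_cohen_macaulay] := @sg_iso_label m G 1 2 isT G42; apply.
- by have [f /label_2_3_cohen_macaulay] := @sg_iso_label m G 2 3 isT G63; apply.
have [a [h [ah G_iso]]] := cubic_circulant Gconn Gcirc Gcubic.
have [f f_lab] := sg_iso_label ah G_iso.
(* A linear relation between [a] and [h] makes both multiples of some [d], which connectedness
   forces to be 1. *)
have scale d p q : a = (p * d)%N -> h = (q * d)%N -> a = p /\ h = q.
  move=> ad hd; have d1 : d = 1%N.
    by apply: (connected_label_dvdn Gconn ah f_lab); rewrite ?ad ?hd dvdn_mull.
  by rewrite ad hd d1 !muln1.
have [e2|n2] := eqVneq (a + a)%N h.
  have [a_eq h_eq] : a = 1%N /\ h = 2%N by apply: (scale a); lia.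
  by left; rewrite a_eq h_eq in G_iso.
have [e32|n32] := eqVneq (3 * a)%N (2 * h)%N.
  (* From [3a = 2h] the common divisor is [h - a]; the witnesses below arise likewise. *)
  have [a_eq h_eq] : a = 2%N /\ h = 3%N by apply: (scale (h - a)%N); lia.
  by right; rewrite a_eq h_eq in G_iso.
exfalso; have [e3|n3] := eqVneq (3 * a)%N h.
  have [a_eq h_eq] : a = 1%N /\ h = 3%N by apply: (scale a); lia.
  by rewrite a_eq h_eq in f_lab; apply: label_1_3_not_cohen_macaulay f_lab cmG.
have [e4|n4] := eqVneq (4 * a)%N h.
  have [a_eq h_eq] : a = 1%N /\ h = 4%N by apply: (scale a); lia.
  rewrite a_eq h_eq in f_lab.
  (* The unit 3 is its own inverse modulo 8 and sends 1 to 3. *)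
  have [f' f'_lab] := @circ_label_mul m G 1 3 4 3 3 f isT isT isT f_lab.
  by apply: winding_not_cohen_macaulay f'_lab cmG; left.
have [e43|n43] := eqVneq (4 * a)%N (3 * h)%N.
  have [a_eq h_eq] : a = 3%N /\ h = 4%N by apply: (scale (h - a)%N); lia.
  rewrite a_eq h_eq in f_lab.
  by apply: (@winding_not_cohen_macaulay k m G 4) f_lab cmG; left.
have [e52|n52] := eqVneq (5 * a)%N (2 * h)%N.
  have [a_eq h_eq] : a = 2%N /\ h = 5%N by apply: (scale (h - (a + a))%N); lia.
  rewrite a_eq h_eq in f_lab.
  (* The unit 3 has inverse 7 modulo 10 and sends 2 to 6, which is -4. *)
  have [f' f'_lab] := @circ_label_mul m G 2 4 5 3 7 f isT isT isT f_lab.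
  by apply: winding_not_cohen_macaulay f'_lab cmG; right.
have [e54|n54] := eqVneq (5 * a)%N (4 * h)%N.
  have [a_eq h_eq] : a = 4%N /\ h = 5%N by apply: (scale (h - a)%N); lia.
  rewrite a_eq h_eq in f_lab.
  by apply: (@winding_not_cohen_macaulay k m G 5) f_lab cmG; right.
by apply: (label_not_cohen_macaulay ah f_lab) cmG.
Qed.
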